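(* Let $\hbar,M,k>0$ be real constants and $0\le\delta\le\frac12$. The planar differential equations $$x'=\frac{\hbar k}{M}\left(-1+\frac{\delta}{k}\,\frac{y}{x^2+y^2}\right),\qquad y'=-\frac{\hbar k}{M}\left(\frac{\delta}{k}\,\frac{x}{x^2+y^2}\right)$$ on $\mathbb R^2\setminus\{(0,0)\}$ (for $\delta=0$: $x'=-\hbar k/M$, $y'=0$ on all of $\mathbb R^2$) are Hamiltonian differential equations with Hamiltonian $$H(x,y,\delta)=\frac{\hbar k}{M}\left(\frac{\delta}{k}\log\sqrt{x^2+y^2}-y\right).$$ Their phase portraits are as follows. (1) If $\delta=0$, the orbits are the horizontal lines $y=c_0$, $c_0\in\mathbb R$, traversed to the left with constant velocity $(-\hbar k/M,0)$. (2) If $\delta>0$, the orbits are contained in the level curves of $H(\cdot,\cdot,\delta)$ and the collection of orbits is symmetric with respect to the $y$-axis. There is exactly one equilibrium point, $(0,\delta/k)$, and it is a saddle. Its separatrices are subsets of the level curve $$L(\delta)=\left\{(x,y)\in\mathbb R^2\setminus\{(0,0)\} : H(x,y,\delta)=\frac{\hbar\delta}{M}\left(\log\frac{\delta}{k}-1\right)\right\}.$$ There is a homoclinic orbit of $(0,\delta/k)$ which, together with this point, forms a closed curve bounding a neighborhood of the origin, and this neighborhood, with the origin removed, is filled with cycles (periodic orbits) surrounding $(0,0)$.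
   Context: A planar system is called a system of Hamiltonian differential equations with Hamiltonian $H$ if it has the form $x'=\frac{\partial H}{\partial y}(x,y)$, $y'=-\frac{\partial H}{\partial x}(x,y)$, where $H$ is a real $C^2$ function on the domain of the system. The separatrices of a saddle are the nonconstant orbits that tend to it in forward or backward time; an orbit is homoclinic to it if it tends to it both in forward and in backward time. *)

(* Defs.v *)
From Stdlib Require Export Reals.
From Coquelicot Require Export Coquelicot.
Open Scope R_scope.

Definition plane : Type := (R * R)%type.

Record planar_system := PlanarSystem {
  dom : plane -> Prop;
  field : plane -> plane
}.

Definition in_itv (a b : Rbar) (t : R) : Prop := Rbar_lt a t /\ Rbar_lt t b.

Definition solution (S : planar_system) (a b : Rbar) (g : R -> plane) : Prop :=
  Rbar_lt a b /\
  forall t, in_itv a b t -> dom S (g t) /\ is_derive g t (field S (g t)).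

(* The values of [g] outside the interval are irrelevant. *)
Definition maximal_solution (S : planar_system) (a b : Rbar) (g : R -> plane)
  : Prop :=
  solution S a b g /\
  forall a' b' g', solution S a' b' g' ->
    Rbar_le a' a -> Rbar_le b b' ->
    (forall t, in_itv a b t -> g' t = g t) ->
    a' = a /\ b' = b.

Definition is_trace (a b : Rbar) (g : R -> plane) (O : plane -> Prop) : Prop :=
  forall p, O p <-> exists t, in_itv a b t /\ g t = p.

Definition is_orbit (S : planar_system) (O : plane -> Prop) : Prop :=
  exists a b g, maximal_solution S a b g /\ is_trace a b g O.

Definition nonconstant (O : plane -> Prop) : Prop :=
  exists p q, O p /\ O q /\ p <> q.

Definition tends_forward (S : planar_system) (O : plane -> Prop) (p : plane)
  : Prop :=
  exists a g, maximal_solution S a p_infty g /\ is_trace a p_infty g O /\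
    filterlim g (Rbar_locally p_infty) (locally p).

Definition tends_backward (S : planar_system) (O : plane -> Prop) (p : plane)
  : Prop :=
  exists b g, maximal_solution S m_infty b g /\ is_trace m_infty b g O /\
    filterlim g (Rbar_locally m_infty) (locally p).

Definition is_separatrix (S : planar_system) (p : plane) (O : plane -> Prop)
  : Prop :=
  is_orbit S O /\ nonconstant O /\ (tends_forward S O p \/ tends_backward S O p).

Definition is_homoclinic (S : planar_system) (p : plane) (O : plane -> Prop)
  : Prop :=
  is_orbit S O /\ nonconstant O /\ tends_forward S O p /\ tends_backward S O p.

Definition is_cycle (S : planar_system) (O : plane -> Prop) : Prop :=
  nonconstant O /\
  exists (g : R -> plane) (T : R),
    maximal_solution S m_infty p_infty g /\ is_trace m_infty p_infty g O /\
    0 < T /\ forall t, g (t + T) = g t.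

Definition is_equilibrium (S : planar_system) (p : plane) : Prop :=
  dom S p /\ field S p = (0, 0).

Definition is_eigenvalue (l : plane -> plane) (lam : R) : Prop :=
  exists v : plane, v <> (0, 0) /\ l v = (lam * fst v, lam * snd v).

(* An equilibrium whose linearization [l] has real eigenvalues of opposite
   signs; in dimension two these are all the eigenvalues. *)
Definition is_saddle (S : planar_system) (p : plane) : Prop :=
  is_equilibrium S p /\
  exists l : plane -> plane,
    filterdiff (K := R_AbsRing) (field S) (locally p) l /\
    exists lam mu, lam < 0 < mu /\ is_eigenvalue l lam /\ is_eigenvalue l mu.

(* [ex_diff_n H 2] at every point of the open domain: [H] is of class C^2. *)
Definition is_hamiltonian (S : planar_system) (H : R -> R -> R) : Prop :=
  open (dom S) /\
  forall x y, dom S (x, y) ->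
    ex_diff_n H 2 x y /\
    field S (x, y) =
      (Derive (fun v => H x v) y, - Derive (fun u => H u y) x).

Definition reflect_y_axis (O : plane -> Prop) : plane -> Prop :=
  fun p => O (- fst p, snd p).

Definition path_connected (U : plane -> Prop) : Prop :=
  forall p q, U p -> U q ->
    exists c : R -> plane, c 0 = p /\ c 1 = q /\
      forall t, 0 <= t <= 1 -> continuous c t /\ U (c t).

Definition bounded_set (U : plane -> Prop) : Prop :=
  exists r, forall p, U p -> Rabs (fst p) <= r /\ Rabs (snd p) <= r.

Definition frontier (U : plane -> Prop) : plane -> Prop :=
  fun p => forall eps : posreal,
    (exists q, ball p eps q /\ U q) /\ (exists q, ball p eps q /\ ~ U q).

(* Simple closed curves. Requiring two-sided continuity at 0 and 1 is harmless:
   a path on [0,1] can be extended by constants. *)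
Definition is_closed_curve (C : plane -> Prop) : Prop :=
  exists c : R -> plane,
    (forall t, 0 <= t <= 1 -> continuous c t) /\
    c 0 = c 1 /\
    (forall s t, 0 <= s < 1 -> 0 <= t < 1 -> c s = c t -> s = t) /\
    (forall p, C p <-> exists t, 0 <= t <= 1 /\ c t = p).

(* For a simple closed curve [C], its interior in the sense of the Jordan curve
   theorem is the only such [U]. *)
Definition bounds (C U : plane -> Prop) : Prop :=
  open U /\ path_connected U /\ bounded_set U /\
  (forall p, frontier U p <-> C p).

Definition surrounds (C : plane -> Prop) (p : plane) : Prop :=
  exists U, bounds C U /\ U p.

Definition sys_dom (delta : R) : plane -> Prop :=
  fun p => delta = 0 \/ p <> (0, 0).

(* Since division is total in [R], for [delta = 0] both formulas below are also
   the intended ones at the origin: the field is [(- (hbar * k / M), 0)] and the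
   Hamiltonian is [- (hbar * k / M) * y] on the whole plane. *)
Definition sys_field (hbar M k delta : R) : plane -> plane :=
  fun p => let (x, y) := p in
    (hbar * k / M * (-1 + delta / k * (y / (x ^ 2 + y ^ 2))),
     - (hbar * k / M) * (delta / k * (x / (x ^ 2 + y ^ 2)))).

Definition sys (hbar M k delta : R) : planar_system :=
  PlanarSystem (sys_dom delta) (sys_field hbar M k delta).

Definition Ham (hbar M k x y delta : R) : R :=
  hbar * k / M * (delta / k * ln (sqrt (x ^ 2 + y ^ 2)) - y).

Definition level_curve (hbar M k delta c : R) : plane -> Prop :=
  fun p => sys_dom delta p /\ Ham hbar M k (fst p) (snd p) delta = c.

Definition L (hbar M k delta : R) : plane -> Prop :=
  fun p => p <> (0, 0) /\
    Ham hbar M k (fst p) (snd p) delta = hbar * delta / M * (ln (delta / k) - 1).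

(* Main.v *)
From Stdlib Require Import Lra ClassicalEpsilon.
Require Import Defs.

(** Write [m = delta / k] for the height of the equilibrium and put [x = m * X],
    [y = m * Y]. Up to the time scale [kap = hbar * k / M / m] the system reads
    [X' = -1 + Y / R^2], [Y' = - X / R^2] with [R^2 = X^2 + Y^2], and a level curve
    of the Hamiltonian is [R = E * exp Y] for a constant [E > 0]. The equilibrium is
    [(0, 1)], on the level [E = exp (-1)]. For [E <= exp (-1)] the part of the level
    curve with [Y <= 1] is a closed curve around the origin ([contour]), and it is the
    boundary of the set of points with [Y < 1] and [R < E * exp Y] ([region]), which
    is star-shaped about the origin. A point of the region of level [exp (-1)] other
    than the origin lies on a contour of smaller level. What has to be shown is that
    the contours with [E < exp (-1)] are periodic orbits and that the contour of level
    [exp (-1)], without the equilibrium, is a homoclinic orbit.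

    In terms of the angle [al] with [X = R * sin al], [Y = R * cos al], the equation of
    the contour becomes [Y * exp (- Y) = E * cos al]. As [v * exp (- v)] increases for
    [v <= 1], this determines [Y] as a function of the angle ([lambert]), so that the
    contour is parametrized by [al] ([contour_point]). The angle itself obeys the
    scalar equation [al' = kap * (1 - Y) / R^2] ([contour_point_solution]), whose
    right-hand side depends on [al] only, and a scalar equation is solved by
    inverting its travel time ([quadrature]).

    If [E < exp (-1)], the right-hand side is positive, bounded and periodic, whence a
    solution on the whole line that gains [2 * PI] per period ([contour_is_cycle]). If
    [E = exp (-1)], it vanishes at the multiples of [2 * PI], to the first order
    because [1 - Y <= sqrt (2 * (1 - cos al))] ([lambert_sqrt_bound]). In the variable
    [s] with [al = 4 * atan (exp s)] the equation for [s] has a positive bounded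
    right-hand side again, so that [al] runs from [0] to [2 * PI] in infinite time
    ([loop_is_homoclinic]). These solutions live on the whole line and are therefore
    maximal.

    The other claims are direct: [H] is constant along solutions and continuous at the
    equilibrium, which puts the separatrices on its level; reflecting a solution in
    the [y]-axis and reversing time gives a solution; and the linearization at the
    equilibrium is [(u, v) |-> (- kap * v, - kap * u)]. *)

(** * Calculus in the plane *)

Lemma continuous_pair {T : UniformSpace} (f g : T -> R) (t : T) :
  continuous f t -> continuous g t -> continuous (fun u => (f u, g u) : plane) t.
Proof.
  intros Hf Hg.
  apply (continuous_comp_2 f g (fun a b => (a, b) : plane)); trivial.
  apply continuous_ext with (f := fun x : R * R => x).
  - intros [a b]; reflexivity.
  - apply continuous_id.
Qed.

Lemma is_derive_pair (f g : R -> R) (t u v : R) :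
  is_derive f t u -> is_derive g t v ->
  is_derive (fun s => (f s, g s) : plane) t ((u, v) : plane).
Proof.
  intros Hf Hg.
  apply (filterdiff_ext_lin _ (fun y : R => (scal y u, scal y v) : plane)).
  2: intros y; reflexivity.
  apply (filterdiff_comp_2 (K := R_AbsRing) f g (fun a b => (a, b) : plane)
           (fun y => scal y u) (fun y => scal y v) (fun a b => (a, b) : plane)).
  - exact Hf.
  - exact Hg.
  - apply filterdiff_linear, is_linear_prod.
    + apply is_linear_fst.
    + apply is_linear_snd.
Qed.

Lemma is_derive_fst (g : R -> plane) (t : R) (v : plane) :
  is_derive g t v -> is_derive (fun s => fst (g s)) t (fst v).
Proof.
  intros H.
  apply (filterdiff_comp g (fun p : plane => fst p) (fun y : R => scal y v : plane)
           (fun p : plane => fst p) H).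
  apply filterdiff_linear, is_linear_fst.
Qed.

Lemma is_derive_snd (g : R -> plane) (t : R) (v : plane) :
  is_derive g t v -> is_derive (fun s => snd (g s)) t (snd v).
Proof.
  intros H.
  apply (filterdiff_comp g (fun p : plane => snd p) (fun y : R => scal y v : plane)
           (fun p : plane => snd p) H).
  apply filterdiff_linear, is_linear_snd.
Qed.

Lemma is_derive_zero_const (a b : Rbar) (f : R -> R) :
  (forall t, in_itv a b t -> is_derive f t 0) ->
  forall s t, in_itv a b s -> in_itv a b t -> f s = f t.
Proof.
  intros H.
  assert (W : forall s t, in_itv a b s -> in_itv a b t -> s < t -> f s = f t).
  { intros s t [Hs _] [_ Ht] Hst.
    apply (eq_is_derive (V := R_NormedModule) f s t); trivial.
    intros r Hr. apply H. split.
    - apply Rbar_lt_le_trans with (Finite s); trivial. simpl; lra.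
    - apply Rbar_le_lt_trans with (Finite t); trivial. simpl; lra. }
  intros s t Hs Ht.
  destruct (Rtotal_order s t) as [h|[h|h]].
  - auto.
  - now subst.
  - symmetry; auto.
Qed.

(** * Inverse functions and quadrature *)

Lemma strict_incr_inj_lt (f : R -> R) :
  (forall x y, x < y -> f x < f y) -> forall x y, f x < f y -> x < y.
Proof.
  intros H x y h. destruct (Rtotal_order x y) as [h'|[h'|h']]; trivial.
  - subst; lra.
  - apply H in h'; lra.
Qed.

Lemma incr_bijection_inverse (f : R -> R) :
  (forall x y, x < y -> f x < f y) ->
  (forall x, continuous f x) ->
  (forall y, exists a b, f a <= y <= f b) ->
  exists g : R -> R,
    (forall y, f (g y) = y) /\ (forall x, g (f x) = x) /\
    (forall x y, x < y -> g x < g y) /\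
    (forall y, continuous g y) /\
    (forall y l, is_derive f (g y) l -> l <> 0 -> is_derive g y (/ l)).
Proof.
  intros Hinc Hcont Hsurj.
  assert (Hex : forall y, exists x, f x = y).
  { intros y. destruct (Hsurj y) as (a & b & Hab).
    destruct (IVT_gen_consistent f a b y Hcont) as (x & _ & Hx).
    - generalize (Rmin_l (f a) (f b)) (Rmax_r (f a) (f b)); lra.
    - now exists x. }
  set (g := fun y => proj1_sig (constructive_indefinite_description _ (Hex y))).
  assert (Hfg : forall y, f (g y) = y)
    by (intros y; exact (proj2_sig (constructive_indefinite_description _ (Hex y)))).
  clearbody g.
  assert (Hlt := strict_incr_inj_lt f Hinc).
  assert (Hgf : forall x, g (f x) = x).
  { intros x. destruct (Rtotal_order (g (f x)) x) as [h|[h|h]]; trivial;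
      apply Hinc in h; rewrite Hfg in h; lra. }
  assert (Hg : forall x y, x < y -> g x < g y).
  { intros x y h. apply Hlt. now rewrite !Hfg. }
  assert (Hgc : forall y, continuous g y).
  { intros y. apply continuity_pt_filterlim.
    apply (Ranalysis5.continuity_pt_recip_interv f g (g y - 1) (g y + 1)).
    - lra.
    - intros; now apply Hinc.
    - intros x _ _. apply Hfg.
    - intros x h1 h2. split; apply Rnot_lt_le; intro h; apply Hinc in h;
        rewrite Hfg in h; lra.
    - intros a _. apply continuity_pt_filterlim, Hcont.
    - assert (h1 := Hinc (g y - 1) (g y) ltac:(lra)).
      assert (h2 := Hinc (g y) (g y + 1) ltac:(lra)).
      rewrite Hfg in h1, h2; lra. }
  exists g. do 4 (split; trivial).
  intros y l Hd Hl.
  apply is_derive_Reals. apply is_derive_Reals in Hd.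
  (* The difference quotient of [g] is the reciprocal of that of [f]. *)
  assert (Hq : filterlim (fun k => (f (g y + k) - f (g y)) / k)
                 (locally' 0) (locally l)).
  { apply filterlim_locally. intros eps.
    destruct (Hd eps (cond_pos eps)) as (del & Hdel).
    exists del. intros k Hk Hk0.
    apply Hdel; trivial. change (Rabs (k - 0) < del) in Hk.
    now rewrite Rminus_0_r in Hk. }
  assert (Hk : filterlim (fun h => g (y + h) - g y) (locally' 0) (locally' 0)).
  { intros P HP.
    assert (Hc : filterlim (fun h => g (y + h) - g y) (locally 0) (locally 0)).
    { assert (E : 0 = g (y + 0) - g y) by (rewrite Rplus_0_r; ring).
      rewrite E at 2.
      apply (continuous_minus (fun h => g (y + h)) (fun _ => g y)).
      - apply (continuous_comp (fun h => y + h) g); [|apply Hgc].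
        apply (continuous_plus (fun _ => y) (fun h => h)).
        + apply continuous_const.
        + apply continuous_id.
      - apply continuous_const. }
    specialize (Hc _ HP). unfold filtermap in *. unfold locally', within in *.
    revert Hc. apply filter_imp. intros h Hh Hh0. apply Hh.
    intro E. assert (E' : g (y + h) = g y) by lra.
    apply (f_equal f) in E'. rewrite !Hfg in E'. apply Hh0. lra. }
  assert (Hlim := filterlim_comp _ _ _ _ _ _ _ _ Hk
           (filterlim_comp _ _ _ _ _ _ _ _ Hq
             (filterlim_Rbar_inv (Finite l) ltac:(intro E; injection E; exact Hl)))).
  intros eps Heps.
  assert (Hl2 := proj1 (filterlim_locally _ (/ l)) Hlim (mkposreal eps Heps)).
  destruct Hl2 as (del & Hdel). exists del. intros h h0 Hh.
  specialize (Hdel h). unfold ball in Hdel; simpl in Hdel.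
  unfold AbsRing_ball, abs, minus, plus, opp in Hdel; simpl in Hdel.
  assert (E : / ((f (g y + (g (y + h) - g y)) - f (g y)) / (g (y + h) - g y))
              = (g (y + h) - g y) / h).
  { replace (g y + (g (y + h) - g y)) with (g (y + h)) by ring.
    rewrite !Hfg. replace (y + h - y) with h by ring.
    field. split; trivial.
    intro E. assert (E' : g (y + h) = g y) by lra.
    apply (f_equal f) in E'. rewrite !Hfg in E'. apply h0; lra. }
  rewrite E in Hdel. apply Hdel; trivial.
  now rewrite Ropp_0, Rplus_0_r.
Qed.

(** The travel time [tau] is the primitive of [1 / f]. The bound on [f] makes it
    unbounded in both directions, so that its inverse [s] is defined at all times. *)
Lemma quadrature (f : R -> R) (K : R) :
  (forall s, continuous f s) -> (forall s, 0 < f s <= K) ->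
  exists tau s : R -> R,
    (forall x, is_derive tau x (/ f x)) /\
    (forall x y, x < y -> tau x < tau y) /\
    (forall t, tau (s t) = t) /\ (forall x, s (tau x) = x) /\
    (forall t u, t < u -> s t < s u) /\
    (forall t, is_derive s t (f (s t))).
Proof.
  intros Hc Hf.
  assert (HK : 0 < K) by (specialize (Hf 0); lra).
  assert (Hci : forall x, continuous (fun x => / f x) x).
  { intros x. apply continuous_comp; [apply Hc|].
    apply (filterlim_Rbar_inv (Finite (f x))).
    intro E; injection E. specialize (Hf x); lra. }
  set (tau := fun x => RInt (fun x => / f x) 0 x).
  assert (Hd : forall x, is_derive tau x (/ f x)).
  { intros x. apply (is_derive_RInt (fun x => / f x) tau 0); [|apply Hci].
    apply filter_forall. intros b.
    apply (RInt_correct (V := R_CompleteNormedModule)).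
    apply ex_RInt_continuous. intros; apply Hci. }
  assert (Hmono : forall x y, x < y -> (y - x) / K <= tau y - tau x).
  { intros x y h.
    destruct (MVT_gen tau x y (fun x => / f x)) as (c & Hcc & E).
    - intros z _. apply Hd.
    - intros z _. apply continuity_pt_filterlim.
      apply (ex_derive_continuous (V := R_NormedModule)). eexists; apply Hd.
    - rewrite E. rewrite (Rmult_comm (/ f c)).
      apply Rmult_le_compat_l; [lra|]. specialize (Hf c).
      apply Rinv_le_contravar; lra. }
  assert (Hinc : forall x y, x < y -> tau x < tau y).
  { intros x y h. specialize (Hmono x y h).
    assert (0 < (y - x) / K) by (apply Rdiv_lt_0_compat; lra). lra. }
  assert (T0 : tau 0 = 0) by apply (RInt_point (V := R_CompleteNormedModule)).
  destruct (incr_bijection_inverse tau) as (s & H1 & H2 & H3 & _ & H5).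
  - exact Hinc.
  - intros x. apply (ex_derive_continuous (V := R_NormedModule)). eexists; apply Hd.
  - intros y. exists (- (Rabs y * K + 1)), (Rabs y * K + 1).
    assert (0 <= Rabs y * K)
      by (apply Rmult_le_pos; [apply Rabs_pos|lra]).
    assert (0 < / K) by now apply Rinv_0_lt_compat.
    assert (h1 := Hmono (- (Rabs y * K + 1)) 0 ltac:(lra)).
    assert (h2 := Hmono 0 (Rabs y * K + 1) ltac:(lra)).
    replace ((0 - - (Rabs y * K + 1)) / K) with (Rabs y + / K) in h1 by (field; lra).
    replace ((Rabs y * K + 1 - 0) / K) with (Rabs y + / K) in h2 by (field; lra).
    assert (h3 := Rle_abs y). assert (h4 := Rle_abs (- y)).
    rewrite Rabs_Ropp in h4. lra.
  - exists tau, s. do 5 (split; trivial).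
    intros t. specialize (Hf (s t)).
    rewrite <- (Rinv_inv (f (s t))). apply H5; [apply Hd|].
    apply Rinv_neq_0_compat; lra.
Qed.

(** The travel time over a period does not depend on where it starts. *)
Lemma quadrature_periodic (f tau s : R -> R) (P : R) :
  0 < P -> (forall x, f (x + P) = f x) ->
  (forall x, is_derive tau x (/ f x)) ->
  (forall x y, x < y -> tau x < tau y) ->
  (forall t, tau (s t) = t) -> (forall x, s (tau x) = x) ->
  exists T, 0 < T /\ forall t, s (t + T) = s t + P.
Proof.
  intros HP Hper Hd Hinc H1 H2.
  assert (Hcst : forall x, tau (x + P) - tau x = tau P - tau 0).
  { intros x. replace (tau P) with (tau (0 + P)) by (f_equal; ring).
    apply (is_derive_zero_const m_infty p_infty (fun x => tau (x + P) - tau x));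
      [|now split|now split].
    intros z _.
    replace 0 with (minus (scal 1 (/ f (z + P))) (/ f z)).
    2: { rewrite Hper. unfold minus, plus, opp, scal, mult; simpl.
         unfold mult; simpl. ring. }
    apply (is_derive_minus (fun x => tau (x + P)) tau); [|apply Hd].
    apply (is_derive_comp tau (fun x => x + P)); [apply Hd|].
    auto_derive; trivial; ring. }
  exists (tau P - tau 0). split.
  - specialize (Hinc 0 P HP). lra.
  - intros t. rewrite <- (H2 (s t + P)). f_equal.
    specialize (Hcst (s t)). rewrite H1 in Hcst. lra.
Qed.

(** * The inverse of [v * exp (- v)] *)

Lemma exp_le_compat (x y : R) : x <= y -> exp x <= exp y.
Proof. intros [h| ->]; [now apply Rlt_le, exp_increasing|apply Rle_refl]. Qed.

Lemma v_exp_incr (x y : R) : x < y -> y <= 1 -> x * exp (- x) < y * exp (- y).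
Proof.
  intros h hy.
  destruct (MVT_cor2 (fun v => v * exp (- v)) (fun v => (1 - v) * exp (- v)) x y h)
    as (c & E & Hc).
  - intros c _. apply is_derive_Reals. auto_derive; trivial. ring.
  - assert (0 < exp (- c)) by apply exp_pos.
    assert (0 < (1 - c) * exp (- c) * (y - x))
      by (repeat apply Rmult_lt_0_compat; lra).
    lra.
Qed.

Lemma lambert_exists : exists V : R -> R,
  (forall z, z <= exp (-1) -> V z <= 1 /\ V z * exp (- V z) = z) /\
  (forall v, v <= 1 -> V (v * exp (- v)) = v) /\
  (forall z, continuous V z) /\
  (forall z, z < exp (-1) -> is_derive V z (/ ((1 - V z) * exp (- V z)))).
Proof.
  (* [mu v] is the minimum of [v] and [1]; beyond its maximum at [1] the
     function is continued by a line, so as to obtain a bijection. *)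
  set (mu := fun v => (v + 1 - Rabs (v - 1)) / 2).
  set (phi := fun v => mu v * exp (- mu v) + (v - mu v)).
  assert (m1 : forall v, v <= 1 -> mu v = v)
    by (intros v h; unfold mu; rewrite Rabs_left1; lra).
  assert (m2 : forall v, 1 <= v -> mu v = 1)
    by (intros v h; unfold mu; rewrite Rabs_pos_eq; lra).
  assert (p1 : forall v, v <= 1 -> phi v = v * exp (- v))
    by (intros v h; unfold phi; rewrite m1; trivial; ring).
  assert (p2 : forall v, 1 <= v -> phi v = exp (-1) + (v - 1))
    by (intros v h; unfold phi; rewrite m2 by trivial;
        change (- (1)) with (-1); ring).
  assert (Hinc : forall x y, x < y -> phi x < phi y).
  { intros x y h. destruct (Rle_dec y 1) as [hy|hy].
    - rewrite !p1 by lra. now apply v_exp_incr.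
    - rewrite (p2 y) by lra. destruct (Rle_dec x 1) as [hx|hx].
      + rewrite p1 by trivial. destruct (Req_dec x 1) as [->|hx1].
        * change (- (1)) with (-1). lra.
        * assert (h1 := v_exp_incr x 1 ltac:(lra) ltac:(lra)).
          change (- (1)) with (-1) in h1. lra.
      + rewrite p2; lra. }
  destruct (incr_bijection_inverse phi) as (V & H1 & H2 & H3 & H4 & H5).
  - exact Hinc.
  - assert (Hmu : forall x, continuous mu x).
    { intros x. unfold mu, Rdiv. apply (continuous_mult (K := R_AbsRing));
        [|apply continuous_const].
      apply (continuous_minus (V := R_NormedModule)).
      - apply (ex_derive_continuous (V := R_NormedModule)). auto_derive; trivial.
      - apply continuous_Rabs_comp.
        apply (ex_derive_continuous (V := R_NormedModule)). auto_derive; trivial. }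
    intros x. unfold phi.
    apply (continuous_plus (V := R_NormedModule)).
    + apply (continuous_mult (K := R_AbsRing)); [apply Hmu|].
      apply continuous_exp_comp, (continuous_opp (V := R_NormedModule)), Hmu.
    + apply (continuous_minus (V := R_NormedModule)); [apply continuous_id|apply Hmu].
  - intros y. assert (0 < exp (-1)) by apply exp_pos.
    assert (h1 := Rle_abs y). assert (h2 := Rle_abs (- y)). rewrite Rabs_Ropp in h2.
    exists (- Rabs y), (Rabs y + 1). split.
    + rewrite p1 by lra.
      assert (h3 := exp_ineq1_le (- - Rabs y)).
      assert (Rabs y * 1 <= Rabs y * exp (- - Rabs y))
        by (apply Rmult_le_compat_l; lra).
      lra.
    + rewrite p2; lra.
  - assert (hp1 : phi 1 = exp (-1)) by (rewrite p1 by lra; change (- (1)) with (-1); ring).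
    assert (Hle : forall z, z <= exp (-1) -> V z <= 1).
    { intros z hz. apply Rnot_lt_le. intros h. apply Hinc in h.
      rewrite H1 in h. lra. }
    exists V. split; [|split; [|split]]; trivial.
    + intros z hz. split; auto. rewrite <- p1; auto.
    + intros v hv. rewrite <- p1 by trivial. apply H2.
    + intros z hz.
      assert (hV : V z < 1).
      { destruct (Hle z ltac:(lra)) as [h|h]; trivial.
        assert (h' := H1 z). rewrite h in h'. lra. }
      apply H5.
      * apply (is_derive_ext_loc (fun v => v * exp (- v))).
        -- apply (locally_open (fun v => v < 1)); trivial.
           ++ apply open_lt.
           ++ intros v hv. rewrite p1; lra.
        -- auto_derive; trivial. ring.
      * apply Rgt_not_eq, Rmult_lt_0_compat; [lra|apply exp_pos].
Qed.

(** In terms of the principal branch [W] of the Lambert function this is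
    [z |-> - W (- z)]. *)
Definition lambert : R -> R :=
  proj1_sig (constructive_indefinite_description _ lambert_exists).

Lemma lambert_spec (z : R) : z <= exp (-1) ->
  lambert z <= 1 /\ lambert z * exp (- lambert z) = z.
Proof. apply (proj2_sig (constructive_indefinite_description _ lambert_exists)). Qed.

Lemma lambert_unique (v : R) : v <= 1 -> lambert (v * exp (- v)) = v.
Proof. apply (proj2_sig (constructive_indefinite_description _ lambert_exists)). Qed.

Lemma continuous_lambert (z : R) : continuous lambert z.
Proof. apply (proj2_sig (constructive_indefinite_description _ lambert_exists)). Qed.

Lemma is_derive_lambert (z : R) : z < exp (-1) ->
  is_derive lambert z (/ ((1 - lambert z) * exp (- lambert z))).
Proof. apply (proj2_sig (constructive_indefinite_description _ lambert_exists)). Qed.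

Lemma lambert_lt_1 (z : R) : z < exp (-1) -> lambert z < 1.
Proof.
  intros hz. destruct (lambert_spec z ltac:(lra)) as [[h|h] E]; trivial.
  rewrite h in E. change (- (1)) with (-1) in E. lra.
Qed.

(** At its maximum [v * exp (- v)] is quadratic, so that its inverse deviates
    from [1] like a square root. *)
Lemma lambert_sqrt_bound (z : R) : z <= exp (-1) ->
  (1 - lambert z) ^ 2 <= 2 * (1 - exp 1 * z).
Proof.
  intros hz. destruct (lambert_spec z hz) as [h E].
  set (v := lambert z) in *.
  assert (Hu : forall u, 0 <= u -> 0 <= 1 - (1 - u) * exp u - u ^ 2 / 2).
  { intros u [hu|<-].
    - destruct (MVT_cor2 (fun u => 1 - (1 - u) * exp u - u ^ 2 / 2)
                  (fun u => u * (exp u - 1)) 0 u hu) as (c & Ec & Hc).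
      + intros c _. apply is_derive_Reals. auto_derive; trivial. field.
      + assert (h1 := exp_ineq1_le c).
        assert (0 <= c * (exp c - 1) * (u - 0))
          by (repeat apply Rmult_le_pos; lra).
        rewrite exp_0 in Ec. lra.
    - rewrite exp_0; lra. }
  specialize (Hu (1 - v) ltac:(lra)).
  replace (exp (1 - v)) with (exp 1 * exp (- v)) in Hu
    by (rewrite <- exp_plus; f_equal; ring).
  rewrite <- E.
  replace (exp 1 * (v * exp (- v))) with ((1 - (1 - v)) * (exp 1 * exp (- v)))
    by ring.
  lra.
Qed.

(** * Contours and their interiors *)

Definition radius (p : plane) : R := sqrt (fst p ^ 2 + snd p ^ 2).

(** The bounded branch of the level curve [m * ln (radius p / m) - snd p = m * ln E],
    which is a loop for [0 < E <= exp (-1)], and its interior. Written without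
    the logarithm, the condition makes sense at the origin, which is an interior point. *)
Definition contour (m E : R) : plane -> Prop :=
  fun p => snd p <= m /\ radius p = m * E * exp (snd p / m).

Definition region (m E : R) : plane -> Prop :=
  fun p => snd p < m /\ radius p < m * E * exp (snd p / m).

Lemma level_mul_exp_1 (E : R) : E <= exp (-1) -> E * exp 1 <= 1.
Proof.
  intros hE. apply Rle_trans with (exp (-1) * exp 1).
  - apply Rmult_le_compat_r; [apply Rlt_le, exp_pos|trivial].
  - rewrite <- exp_plus. replace (-1 + 1) with 0 by ring. rewrite exp_0; lra.
Qed.

Lemma radius_pos (p : plane) : p <> (0, 0) -> 0 < radius p.
Proof.
  destruct p as [x y]. intros H. apply sqrt_lt_R0; simpl fst; simpl snd.
  destruct (Req_dec x 0) as [->|hx].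
  - assert (hy : y <> 0) by (intros ->; now apply H).
    assert (h := pow2_gt_0 y hy). lra.
  - assert (h := pow2_gt_0 x hx). assert (h' := pow2_ge_0 y). lra.
Qed.

Lemma radius_sqr (p : plane) : radius p ^ 2 = fst p ^ 2 + snd p ^ 2.
Proof.
  apply pow2_sqrt. generalize (pow2_ge_0 (fst p)) (pow2_ge_0 (snd p)); lra.
Qed.

Lemma abs_le_radius (p : plane) : Rabs (fst p) <= radius p /\ Rabs (snd p) <= radius p.
Proof.
  assert (h : 0 <= radius p) by apply sqrt_pos.
  assert (h2 := radius_sqr p).
  generalize (pow2_ge_0 (fst p)) (pow2_ge_0 (snd p)); intros h3 h4.
  split; rewrite <- (Rabs_pos_eq (radius p)) by trivial;
    apply Rsqr_le_abs_0; unfold Rsqr; nra.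
Qed.

Lemma radius_scale (s : R) (p : plane) :
  0 <= s -> radius (s * fst p, s * snd p) = s * radius p.
Proof.
  intros hs. unfold radius; simpl fst; simpl snd.
  replace ((s * fst p) ^ 2 + (s * snd p) ^ 2)
    with (s ^ 2 * (fst p ^ 2 + snd p ^ 2)) by ring.
  rewrite sqrt_mult_alt by apply pow2_ge_0. now rewrite sqrt_pow2.
Qed.

Lemma continuous_fst_plane (p : plane) : continuous (fun q : plane => fst q) p.
Proof.
  destruct p as [x y].
  apply (continuous_fst (U := R_UniformSpace) (V := R_UniformSpace)).
Qed.

Lemma continuous_snd_plane (p : plane) : continuous (fun q : plane => snd q) p.
Proof.
  destruct p as [x y].
  apply (continuous_snd (U := R_UniformSpace) (V := R_UniformSpace)).
Qed.

Lemma continuous_sqr_norm (p : plane) :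
  continuous (fun q : plane => fst q ^ 2 + snd q ^ 2) p.
Proof.
  assert (H : forall x, continuous (fun u : R => u ^ 2) x).
  { intros x. apply (ex_derive_continuous (V := R_NormedModule)). auto_derive; trivial. }
  apply (continuous_plus (V := R_NormedModule)).
  - apply (continuous_comp (fun q : plane => fst q) (fun u : R => u ^ 2));
      [apply continuous_fst_plane|apply H].
  - apply (continuous_comp (fun q : plane => snd q) (fun u : R => u ^ 2));
      [apply continuous_snd_plane|apply H].
Qed.

Lemma continuous_radius (p : plane) : continuous radius p.
Proof.
  apply (continuous_comp (fun q : plane => fst q ^ 2 + snd q ^ 2) sqrt).
  - apply continuous_sqr_norm.
  - apply continuity_pt_filterlim, continuity_pt_sqrt.
    generalize (pow2_ge_0 (fst p)) (pow2_ge_0 (snd p)); lra.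
Qed.

Lemma continuous_radius_gap (m E : R) (p : plane) :
  continuous (fun q : plane => m * E * exp (snd q / m) - radius q) p.
Proof.
  apply (continuous_minus (V := R_NormedModule)); [|apply continuous_radius].
  apply (continuous_comp (fun q : plane => snd q) (fun y => m * E * exp (y / m))).
  - apply continuous_snd_plane.
  - apply (ex_derive_continuous (V := R_NormedModule)). auto_derive; trivial.
Qed.

Lemma star_shaped_path_connected (U : plane -> Prop) :
  (forall p s, U p -> 0 <= s <= 1 -> U (s * fst p, s * snd p)) -> path_connected U.
Proof.
  intros H p q Hp Hq.
  (* Positive parts of [1 - 2 * t] and [2 * t - 1]: the path goes through the origin. *)
  set (w1 := fun t => (1 - 2 * t + Rabs (1 - 2 * t)) / 2).
  set (w2 := fun t => (2 * t - 1 + Rabs (2 * t - 1)) / 2).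
  assert (W : forall t, (t <= 1 / 2 /\ w1 t = 1 - 2 * t /\ w2 t = 0) \/
                        (1 / 2 <= t /\ w1 t = 0 /\ w2 t = 2 * t - 1)).
  { intros t. unfold w1, w2. destruct (Rle_dec t (1 / 2)) as [h|h].
    - left. rewrite Rabs_pos_eq, Rabs_left1 by lra. lra.
    - right. rewrite Rabs_left1, Rabs_pos_eq by lra. lra. }
  assert (Hw : forall (l : R -> R) t, ex_derive l t ->
                 continuous (fun t => (l t + Rabs (l t)) / 2) t).
  { intros l t Hl. apply (ex_derive_continuous (V := R_NormedModule)) in Hl.
    unfold Rdiv. apply (continuous_mult (K := R_AbsRing)); [|apply continuous_const].
    apply (continuous_plus (V := R_NormedModule)); trivial.
    now apply continuous_Rabs_comp. }
  exists (fun t => (w1 t * fst p + w2 t * fst q, w1 t * snd p + w2 t * snd q)).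
  split; [|split].
  - destruct (W 0) as [(_ & -> & ->)|(h & _)]; [|lra].
    rewrite (surjective_pairing p) at 3. f_equal; ring.
  - destruct (W 1) as [(h & _)|(_ & -> & ->)]; [lra|].
    rewrite (surjective_pairing q) at 3. f_equal; ring.
  - intros t Ht.
    assert (C1 : continuous w1 t) by (apply Hw; auto_derive; trivial).
    assert (C2 : continuous w2 t) by (apply Hw; auto_derive; trivial).
    split.
    + apply (continuous_pair (T := R_UniformSpace));
        apply (continuous_plus (V := R_NormedModule));
        apply (continuous_mult (K := R_AbsRing)); trivial; apply continuous_const.
    + destruct (W t) as [(h & -> & ->)|(h & -> & ->)].
      * replace (((1 - 2 * t) * fst p + 0 * fst q, (1 - 2 * t) * snd p + 0 * snd q))
          with ((1 - 2 * t) * fst p, (1 - 2 * t) * snd p) by (f_equal; ring).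
        apply H; trivial; lra.
      * replace ((0 * fst p + (2 * t - 1) * fst q, 0 * snd p + (2 * t - 1) * snd q))
          with ((2 * t - 1) * fst q, (2 * t - 1) * snd q) by (f_equal; ring).
        apply H; trivial; lra.
Qed.

Lemma frontier_meets_open (U D : plane -> Prop) (p : plane) :
  frontier U p -> open D -> D p ->
  (exists q, D q /\ U q) /\ (exists q, D q /\ ~ U q).
Proof.
  intros HF HD Hp. destruct (HD p Hp) as (eps & He).
  destruct (HF eps) as ((q & Hq & HUq) & (q' & Hq' & HUq')).
  split; [exists q|exists q']; split; trivial; now apply He.
Qed.

(** The logarithm of the radius outgrows the ordinate along a ray as long as the
    ordinate is below [m]: shrinking a point of the closure pulls it inside. *)
Lemma shrink_in_region (m E s : R) (p : plane) :
  0 < m -> 0 < E -> 0 <= s < 1 ->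
  snd p <= m -> radius p <= m * E * exp (snd p / m) ->
  region m E (s * fst p, s * snd p).
Proof.
  intros hm hE hs hy hr. split.
  - simpl. nra.
  - rewrite radius_scale by lra. cbn [snd].
    set (Y := snd p / m) in *.
    assert (hY : Y <= 1) by (apply Rle_div_l; lra).
    replace (s * snd p / m) with (Y + (s - 1) * Y) by (unfold Y; field; lra).
    rewrite exp_plus.
    assert (h1 : s < exp ((s - 1) * Y)).
    { apply Rlt_le_trans with (exp (s - 1)).
      - assert (h := exp_ineq1 (s - 1) ltac:(lra)). lra.
      - apply exp_le_compat. nra. }
    apply Rle_lt_trans with (m * E * exp Y * s).
    + rewrite Rmult_comm. apply Rmult_le_compat_r; lra.
    + rewrite <- Rmult_assoc. apply Rmult_lt_compat_l; trivial.
      assert (0 < exp Y) by apply exp_pos.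
      repeat apply Rmult_lt_0_compat; trivial.
Qed.

Lemma open_region (m E : R) : open (region m E).
Proof.
  apply (open_and (T := prod_UniformSpace R_UniformSpace R_UniformSpace)
           (fun p => snd p < m) (fun p => radius p < m * E * exp (snd p / m))).
  - apply (open_comp (T := prod_UniformSpace R_UniformSpace R_UniformSpace)
             (fun p : plane => snd p) (fun y => y < m)); [|apply open_lt].
    intros p _. apply continuous_snd_plane.
  - apply (open_ext (T := prod_UniformSpace R_UniformSpace R_UniformSpace)
             (fun p => 0 < m * E * exp (snd p / m) - radius p)).
    + intros p. lra.
    + apply (open_comp (T := prod_UniformSpace R_UniformSpace R_UniformSpace)
             (fun p : plane => m * E * exp (snd p / m) - radius p) (fun y => 0 < y));
        [|apply open_gt].
      intros p _. apply continuous_radius_gap.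
Qed.

(** The region is the intersection of two open conditions; a point of its frontier
    violates one of them but satisfies both weakly. It cannot be on the line [y = m]
    with a radius that is too small, as the radius there is at least
    [m >= m * E * exp 1]. *)
Lemma contour_bounds_region (m E : R) :
  0 < m -> 0 < E <= exp (-1) -> bounds (contour m E) (region m E).
Proof.
  intros hm hE.
  assert (hEe := level_mul_exp_1 E (proj2 hE)).
  split; [apply open_region|split; [|split]].
  - apply star_shaped_path_connected. intros p s [h1 h2] [h3 [h4 | ->]].
    + apply shrink_in_region; lra.
    + replace (1 * fst p, 1 * snd p) with p; [now split|].
      rewrite (surjective_pairing p) at 1. f_equal; ring.
  - exists (m * E * exp 1). intros p [h1 h2].
    assert (h3 := abs_le_radius p).
    assert (m * E * exp (snd p / m) <= m * E * exp 1).
    { apply Rmult_le_compat_l.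
      - apply Rmult_le_pos; lra.
      - apply exp_le_compat. apply Rle_div_l; lra. }
    lra.
  - intros p. split.
    + intros HF.
      assert (h1 : snd p <= m).
      { apply Rnot_lt_le. intros h.
        destruct (frontier_meets_open _ (fun q : plane => m < snd q) p HF)
          as [(q & h1 & h2 & _) _];
          trivial; [|lra].
        apply (open_comp (T := prod_UniformSpace R_UniformSpace R_UniformSpace)
             (fun p : plane => snd p) (fun y => m < y)); [|apply open_gt].
        intros q _. apply continuous_snd_plane. }
      assert (h2 : radius p <= m * E * exp (snd p / m)).
      { apply Rnot_lt_le. intros h.
        destruct (frontier_meets_open _
          (fun q : plane => m * E * exp (snd q / m) - radius q < 0) p HF)
          as [(q & h2 & _ & h3) _]; [|lra|lra].
        apply (open_comp (T := prod_UniformSpace R_UniformSpace R_UniformSpace)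
          (fun q : plane => m * E * exp (snd q / m) - radius q) (fun y => y < 0));
          [|apply open_lt].
        intros q _. apply continuous_radius_gap. }
      assert (h3 : ~ region m E p).
      { intros h. destruct (frontier_meets_open _ _ p HF (open_region m E) h)
          as [_ (q & h3 & h4)]. contradiction. }
      split; trivial. destruct h2 as [h2|h2]; trivial. exfalso.
      destruct h1 as [h1|h1]; [apply h3; now split|].
      rewrite h1 in h2. replace (m / m) with 1 in h2 by (field; lra).
      assert (h4 := proj2 (abs_le_radius p)). rewrite h1, Rabs_pos_eq in h4 by lra.
      nra.
    + intros [h1 h2] eps. split.
      * set (r := radius p) in *.
        assert (hr : 0 <= r) by apply sqrt_pos.
        set (s := 1 - Rmin (1 / 2) (eps / (2 * (r + 1)))).
        assert (h3 : 0 < eps / (2 * (r + 1))).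
        { apply Rdiv_lt_0_compat; [apply cond_pos|lra]. }
        assert (h4 := Rmin_l (1 / 2) (eps / (2 * (r + 1)))).
        assert (h5 := Rmin_r (1 / 2) (eps / (2 * (r + 1)))).
        assert (h6 : 0 < Rmin (1 / 2) (eps / (2 * (r + 1))))
          by (apply Rmin_glb_lt; lra).
        exists (s * fst p, s * snd p). split.
        -- assert (B : forall x, Rabs x <= r -> Rabs (s * x - x) < eps).
           { intros x hx. replace (s * x - x) with ((s - 1) * x) by ring.
             rewrite Rabs_mult, (Rabs_left (s - 1)) by (unfold s; lra).
             apply Rle_lt_trans with (eps / (2 * (r + 1)) * (r + 1)).
             - apply Rmult_le_compat; unfold s; try lra. apply Rabs_pos.
             - replace (eps / (2 * (r + 1)) * (r + 1)) with (eps / 2) by (field; lra).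
               generalize (cond_pos eps); lra. }
           destruct (abs_le_radius p) as [a1 a2].
           split; simpl; [apply (B _ a1)|apply (B _ a2)].
        -- apply shrink_in_region; fold r; unfold s; lra.
      * exists p. split; [apply ball_center|].
        intros [_ h3]. lra.
Qed.

Lemma contour_through (m E : R) (q : plane) :
  0 < m -> region m E q -> q <> (0, 0) ->
  exists E', 0 < E' < E /\ contour m E' q.
Proof.
  intros hm [h1 h2] hq. assert (h3 := radius_pos q hq).
  assert (h4 : 0 < exp (snd q / m)) by apply exp_pos.
  assert (h5 : 0 < m * exp (snd q / m)) by now apply Rmult_lt_0_compat.
  exists (radius q / (m * exp (snd q / m))).
  split; [split|split].
  - now apply Rdiv_lt_0_compat.
  - apply (Rlt_div_l (radius q) E (m * exp (snd q / m))); lra.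
  - lra.
  - field; lra.
Qed.

Lemma contour_sub_region (m E E' : R) (p : plane) :
  0 < m -> 0 < E' < E -> E <= exp (-1) -> contour m E' p -> region m E p.
Proof.
  intros hm hE hE1 [h1 h2].
  assert (h3 : 0 < m * exp (snd p / m))
    by (apply Rmult_lt_0_compat; [trivial|apply exp_pos]).
  assert (h4 : radius p < m * E * exp (snd p / m)).
  { rewrite h2. replace (m * E' * exp (snd p / m)) with (E' * (m * exp (snd p / m))) by ring.
    replace (m * E * exp (snd p / m)) with (E * (m * exp (snd p / m))) by ring.
    apply Rmult_lt_compat_r; lra. }
  split; trivial. destruct h1 as [h1|h1]; trivial. exfalso.
  assert (h5 := proj2 (abs_le_radius p)). rewrite h1, Rabs_pos_eq in h5 by lra.
  (* On the line [y = m] the radius is at least [m], which is too large. *)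
  rewrite h1 in h4. replace (m / m) with 1 in h4 by (field; lra).
  assert (hEe := level_mul_exp_1 E hE1).
  nra.
Qed.

Lemma region_origin (m E : R) : 0 < m -> 0 < E -> region m E (0, 0).
Proof.
  intros hm hE. split; simpl; trivial.
  unfold radius; simpl fst; simpl snd. replace (0 ^ 2 + 0 ^ 2) with 0 by ring.
  rewrite sqrt_0. repeat apply Rmult_lt_0_compat; trivial. apply exp_pos.
Qed.

(** * Angular parametrization of the contours *)

(** The angle [al] is measured clockwise from the positive [y]-axis. On the contour
    of level [E] the ordinate [m * Y] satisfies [Y = E * exp Y * cos al], whose
    solution with [Y <= 1] is [lambert (E * cos al)]. *)
Definition contour_point (m E al : R) : plane :=
  (m * (E * exp (lambert (E * cos al)) * sin al), m * lambert (E * cos al)).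

Lemma E_cos_le (E al : R) : 0 < E <= exp (-1) -> E * cos al <= exp (-1).
Proof. intros hE. assert (h := proj2 (COS_bound al)). nra. Qed.

Lemma lambert_E_cos (E al : R) : 0 < E <= exp (-1) ->
  lambert (E * cos al) = E * exp (lambert (E * cos al)) * cos al.
Proof.
  intros hE. destruct (lambert_spec _ (E_cos_le E al hE)) as [_ h].
  set (Y := lambert (E * cos al)) in *.
  assert (h1 : exp (- Y) * exp Y = 1)
    by (rewrite <- exp_plus, Rplus_opp_l; apply exp_0).
  replace (E * exp Y * cos al) with (E * cos al * exp Y) by ring.
  rewrite <- h. rewrite Rmult_assoc, h1. ring.
Qed.

Lemma radius_contour_point (m E al : R) : 0 < m -> 0 < E <= exp (-1) ->
  radius (contour_point m E al) = m * E * exp (lambert (E * cos al)).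
Proof.
  intros hm hE. unfold radius, contour_point; cbn [fst snd].
  rewrite (lambert_E_cos E al hE) at 2.
  set (w := exp (lambert (E * cos al))).
  assert (hw : 0 < w) by apply exp_pos.
  replace ((m * (E * w * sin al)) ^ 2 + (m * (E * w * cos al)) ^ 2)
    with ((m * E * w) ^ 2 * (Rsqr (sin al) + Rsqr (cos al))) by (unfold Rsqr; ring).
  rewrite sin2_cos2, Rmult_1_r. apply sqrt_pow2.
  apply Rlt_le. repeat apply Rmult_lt_0_compat; lra.
Qed.

Lemma contour_contour_point (m E al : R) : 0 < m -> 0 < E <= exp (-1) ->
  contour m E (contour_point m E al).
Proof.
  intros hm hE. destruct (lambert_spec _ (E_cos_le E al hE)) as [h _]. split.
  - cbn [snd contour_point]. nra.
  - rewrite radius_contour_point by trivial. cbn [snd contour_point].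
    do 2 f_equal. field; lra.
Qed.

Lemma unit_circle_angle (a b : R) : a ^ 2 + b ^ 2 = 1 ->
  exists al, 0 <= al < 2 * PI /\ sin al = a /\ cos al = b.
Proof.
  intros h. assert (hb : -1 <= b <= 1) by nra.
  assert (hs : sin (acos b) = Rabs a).
  { rewrite sin_acos by trivial. rewrite <- sqrt_Rsqr_abs. f_equal.
    unfold Rsqr. nra. }
  assert (h1 := acos_bound b). assert (hPI := PI_RGT_0).
  destruct (Rle_dec 0 a) as [ha|ha].
  - exists (acos b). split; [lra|]. split; [|now apply cos_acos].
    now rewrite hs, Rabs_pos_eq.
  - exists (2 * PI - acos b).
    assert (acos b <> 0).
    { intros E. rewrite E, sin_0, Rabs_left in hs; lra. }
    split; [lra|].
    rewrite sin_minus, cos_minus, sin_2PI, cos_2PI, hs, cos_acos by trivial.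
    rewrite Rabs_left by lra. split; ring.
Qed.

Lemma angle_unique (a b : R) : 0 <= a < 2 * PI -> 0 <= b < 2 * PI ->
  sin a = sin b -> cos a = cos b -> a = b.
Proof.
  assert (W : forall a b, a < b -> b - a < 2 * PI ->
                sin a = sin b -> cos a = cos b -> False).
  { clear a b. intros a b h1 h2 hs hc.
    assert (h : 0 < sin ((b - a) / 2)) by (apply sin_gt_0; lra).
    assert (E := cos_2a_sin ((b - a) / 2)).
    replace (2 * ((b - a) / 2)) with (b - a) in E by field.
    rewrite cos_minus, hs, hc in E.
    assert (E2 := sin2_cos2 b). unfold Rsqr in E2. nra. }
  intros ha hb hs hc. destruct (Rtotal_order a b) as [h|[h|h]]; trivial; exfalso.
  - apply (W a b); trivial; lra.
  - apply (W b a); auto; lra.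
Qed.

Lemma contour_point_surj (m E : R) (p : plane) : 0 < m -> 0 < E ->
  contour m E p -> exists al, 0 <= al < 2 * PI /\ contour_point m E al = p.
Proof.
  intros hm hE [h1 h2]. set (Y := snd p / m) in *.
  assert (hY1 : Y <= 1) by (apply Rle_div_l; lra).
  assert (hsp : snd p = m * Y) by (unfold Y; field; lra).
  clearbody Y.
  assert (hw : 0 < exp Y) by apply exp_pos.
  assert (hr : 0 < radius p)
    by (rewrite h2; repeat apply Rmult_lt_0_compat; trivial).
  destruct (unit_circle_angle (fst p / radius p) (snd p / radius p))
    as (al & hal & hs & hc).
  { replace ((fst p / radius p) ^ 2 + (snd p / radius p) ^ 2)
      with ((fst p ^ 2 + snd p ^ 2) / radius p ^ 2) by (field; lra).
    rewrite <- radius_sqr. field; lra. }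
  exists al. split; trivial.
  assert (hY : lambert (E * cos al) = Y).
  { rewrite <- (lambert_unique Y) by trivial.
    f_equal. rewrite hc, h2, exp_Ropp, hsp. field; lra. }
  unfold contour_point. rewrite hY, hs, h2, <- hsp.
  rewrite (surjective_pairing p) at 3.
  f_equal. field; lra.
Qed.

Lemma contour_point_inj (m E a b : R) : 0 < m -> 0 < E <= exp (-1) ->
  0 <= a < 2 * PI -> 0 <= b < 2 * PI ->
  contour_point m E a = contour_point m E b -> a = b.
Proof.
  intros hm hE ha hb H. injection H as h1 h2.
  apply Rmult_eq_reg_l in h2; [|lra].
  assert (ea := lambert_E_cos E a hE). assert (eb := lambert_E_cos E b hE).
  rewrite <- h2 in eb. rewrite <- h2 in h1.
  set (Y := lambert (E * cos a)) in *.
  assert (hw : 0 < E * exp Y) by (apply Rmult_lt_0_compat; [lra|apply exp_pos]).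
  apply Rmult_eq_reg_l in h1; [|lra].
  apply Rmult_eq_reg_l in h1; [|lra].
  apply angle_unique; trivial.
  apply (Rmult_eq_reg_l (E * exp Y)); lra.
Qed.

Lemma contour_point_period (m E al : R) :
  contour_point m E (al + 2 * PI) = contour_point m E al.
Proof. unfold contour_point. rewrite cos_plus, sin_plus, cos_2PI, sin_2PI.
  now rewrite !Rmult_0_r, !Rmult_1_r, Rminus_0_r, Rplus_0_r. Qed.

Lemma continuous_lambert_E_cos (E al : R) :
  continuous (fun al => lambert (E * cos al)) al.
Proof.
  apply (continuous_comp (fun al => E * cos al) lambert).
  - apply (ex_derive_continuous (V := R_NormedModule)). auto_derive; trivial.
  - apply continuous_lambert.
Qed.

Lemma continuous_contour_point (m E al : R) : continuous (contour_point m E) al.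
Proof.
  apply (continuous_pair (T := R_UniformSpace)).
  - apply (continuous_mult (K := R_AbsRing)); [apply continuous_const|].
    apply (continuous_mult (K := R_AbsRing)); [|apply continuous_sin].
    apply (continuous_mult (K := R_AbsRing)); [apply continuous_const|].
    apply continuous_exp_comp, continuous_lambert_E_cos.
  - apply (continuous_mult (K := R_AbsRing)); [apply continuous_const|].
    apply continuous_lambert_E_cos.
Qed.

Lemma contour_nonconstant (m E : R) : 0 < m -> 0 < E <= exp (-1) ->
  contour_point m E PI <> contour_point m E (PI / 2).
Proof.
  intros hm hE H. assert (h := PI_RGT_0).
  apply contour_point_inj in H; trivial; lra.
Qed.

Lemma contour_closed_curve (m E : R) : 0 < m -> 0 < E <= exp (-1) ->
  is_closed_curve (contour m E).
Proof.
  intros hm hE. assert (hPI := PI_RGT_0).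
  exists (fun t => contour_point m E (2 * PI * t)). split; [|split; [|split]].
  - intros t _. apply (continuous_comp (fun t => 2 * PI * t) (contour_point m E)).
    + apply (ex_derive_continuous (V := R_NormedModule)). auto_derive; trivial.
    + apply continuous_contour_point.
  - rewrite <- contour_point_period. f_equal. ring.
  - intros s t hs ht H. apply contour_point_inj in H; trivial; nra.
  - intros p. split.
    + intros hp. destruct (contour_point_surj m E p hm ltac:(lra) hp) as (al & h & <-).
      exists (al / (2 * PI)). split.
      * split.
        -- apply Rdiv_le_0_compat; lra.
        -- apply Rle_div_l; lra.
      * f_equal. field; lra.
    + intros (t & _ & <-). now apply contour_contour_point.
Qed.

(** * Motion along the contours *)

(** The rate of change [(x' * y - y' * x) / r^2] of the angle on the contour of level
    [E], the identity [r = m * E * exp Y] being used to eliminate everything but the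
    angle. *)
Definition angular_speed (kap E al : R) : R :=
  kap * (1 - lambert (E * cos al)) / (E * exp (lambert (E * cos al))) ^ 2.

(** Differentiation of [Y * exp (- Y) = E * cos al] gives [Y' = - X * al' / (1 - Y)],
    so that the angular speed is what turns this into the second equation of the
    system; the first one follows from [X = E * exp Y * sin al] and
    [X ^ 2 + Y ^ 2 = (E * exp Y) ^ 2]. *)
Lemma contour_point_solution (hbar M k delta kap E : R) (al : R -> R) (t : R) :
  0 < hbar -> 0 < M -> 0 < k -> 0 < delta -> 0 < E <= exp (-1) ->
  kap = hbar * k / M / (delta / k) ->
  E * cos (al t) < exp (-1) ->
  is_derive al t (angular_speed kap E (al t)) ->
  is_derive (fun s => contour_point (delta / k) E (al s)) t
    (sys_field hbar M k delta (contour_point (delta / k) E (al t))).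
Proof.
  intros hh hM hk hd hE hkap hcos Hal.
  set (m := delta / k). assert (hm : 0 < m) by now apply Rdiv_lt_0_compat.
  set (y := fun s => lambert (E * cos (al s))).
  set (w := exp (y t)). assert (hw : 0 < w) by apply exp_pos.
  assert (hy1 : y t < 1) by now apply lambert_lt_1.
  assert (hyt : y t = E * w * cos (al t)) by now apply lambert_E_cos.
  set (v := angular_speed kap E (al t)) in *.
  assert (Hy : is_derive y t (- (E * sin (al t) * v) / ((1 - y t) / w))).
  { replace (- (E * sin (al t) * v) / ((1 - y t) / w))
      with (scal (- (E * sin (al t) * v)) (/ ((1 - y t) * exp (- y t)))).
    - apply (is_derive_comp lambert (fun s => E * cos (al s))).
      + now apply is_derive_lambert.
      + auto_derive; [now exists v|].
        rewrite (is_derive_unique (fun s : R => al s) t v Hal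
                 : Derive (fun s : R => al s) t = v).
        ring.
    - rewrite exp_Ropp. unfold scal; simpl; unfold mult; simpl. fold w. field. lra. }
  assert (Hr : (m * (E * w * sin (al t))) ^ 2 + (m * y t) ^ 2 = (m * E * w) ^ 2).
  { assert (h := radius_sqr (contour_point m E (al t))).
    rewrite radius_contour_point in h by trivial. symmetry; exact h. }
  assert (Hsc := sin2_cos2 (al t)). unfold Rsqr in Hsc.
  assert (Hc : hbar * k / M = kap * m) by (rewrite hkap; unfold m; field; lra).
  unfold sys_field, contour_point.
  change (lambert (E * cos (al t))) with (y t). fold m w.
  rewrite Hr, Hc. clear Hr.
  assert (hv : v = kap * (1 - y t) / (E * w) ^ 2) by reflexivity.
  apply is_derive_pair.
  - apply (is_derive_ext (fun s => m * (E * exp (y s) * sin (al s)))); [reflexivity|].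
    auto_derive; [split; [now eexists; exact Hy|split; [now exists v|trivial]]|].
    rewrite (is_derive_unique (fun s : R => al s) t v Hal : Derive (fun s : R => al s) t = v),
      (is_derive_unique (fun s : R => y s) t _ Hy : Derive (fun s : R => y s) t = _). fold w.
    set (si := sin (al t)) in *. set (co := cos (al t)) in *.
    rewrite hv.
    transitivity (kap * m * (- (si * si) + (1 - y t) * co / (E * w))).
    + field. lra.
    + transitivity (kap * m * (-1 + y t / (E * w) ^ 2)); [|field; lra].
      f_equal. replace co with (y t / (E * w)) in * by (rewrite hyt; field; lra).
      replace (si * si) with (1 - y t / (E * w) * (y t / (E * w))) by lra.
      field. lra.
  - apply (is_derive_ext (fun s => m * y s)); [reflexivity|].
    auto_derive; [now eexists; exact Hy|].
    rewrite (is_derive_unique (fun s : R => y s) t _ Hy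
               : Derive (fun s : R => y s) t = _), hv.
    field. lra.
Qed.

Lemma entire_maximal (S : planar_system) (g : R -> plane) :
  (forall t, dom S (g t) /\ is_derive g t (field S (g t))) ->
  maximal_solution S m_infty p_infty g.
Proof.
  intros H. split.
  - split; [exact I|]. intros t _. apply H.
  - intros a b g' _ ha hb _. split.
    + now destruct a.
    + now destruct b.
Qed.

Lemma contour_ne_origin (m E : R) (p : plane) :
  0 < m -> 0 < E -> contour m E p -> p <> (0, 0).
Proof.
  intros hm hE [_ h] ->.
  assert (0 < m * E * exp (snd ((0, 0) : plane) / m)).
  { repeat apply Rmult_lt_0_compat; trivial. apply exp_pos. }
  rewrite <- h in H. unfold radius in H; simpl fst in H; simpl snd in H.
  replace (0 ^ 2 + 0 ^ 2) with 0 in H by ring. rewrite sqrt_0 in H. lra.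
Qed.

Lemma continuous_angular_speed (kap E al : R) :
  0 < E -> continuous (angular_speed kap E) al.
Proof.
  intros hE. unfold angular_speed.
  set (Y := fun al => lambert (E * cos al)).
  apply (continuous_comp Y (fun y => kap * (1 - y) / (E * exp y) ^ 2)).
  - apply continuous_lambert_E_cos.
  - apply (ex_derive_continuous (V := R_NormedModule)). auto_derive.
    assert (0 < E * exp (Y al)).
    { apply Rmult_lt_0_compat; [trivial|apply exp_pos]. }
    apply Rgt_not_eq. repeat apply Rmult_lt_0_compat; trivial; try apply exp_pos; lra.
Qed.

Lemma lambert_E_cos_bounds (E al : R) : 0 < E <= exp (-1) ->
  -1 <= lambert (E * cos al) <= 1.
Proof.
  intros hE. destruct (lambert_spec _ (E_cos_le E al hE)) as [h _].
  split; trivial. assert (h1 := lambert_E_cos E al hE).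
  set (Y := lambert (E * cos al)) in *.
  assert (hEe : E * exp Y <= 1).
  { apply Rle_trans with (2 := level_mul_exp_1 E (proj2 hE)).
    apply Rmult_le_compat_l; [lra|now apply exp_le_compat]. }
  assert (0 < E * exp Y) by (apply Rmult_lt_0_compat; [lra|apply exp_pos]).
  assert (0 <= E * exp Y * (cos al + 1))
    by (apply Rmult_le_pos; generalize (COS_bound al); lra).
  lra.
Qed.

(** Contours stay away from the origin, hence the speed is controlled by the
    distance [1 - Y] below the height of the equilibrium. *)
Lemma angular_speed_bounds (kap E al b : R) :
  0 < kap -> 0 < E <= exp (-1) -> E * cos al < exp (-1) ->
  1 - lambert (E * cos al) <= b ->
  0 < angular_speed kap E al <= kap * b / (E * exp (-1)) ^ 2.
Proof.
  intros hkap hE hcos hb.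
  assert (h1 := lambert_lt_1 _ hcos).
  assert (hY := proj1 (lambert_E_cos_bounds E al hE)).
  unfold angular_speed. set (Y := lambert (E * cos al)) in *.
  assert (hw : 0 < exp Y) by apply exp_pos.
  assert (he : 0 < exp (-1)) by apply exp_pos.
  assert (h3 : exp (-1) <= exp Y) by now apply exp_le_compat.
  assert (h4 : 0 < E * exp (-1)) by (apply Rmult_lt_0_compat; lra).
  assert (h5 : E * exp (-1) <= E * exp Y) by (apply Rmult_le_compat_l; lra).
  split.
  - apply Rdiv_lt_0_compat; [apply Rmult_lt_0_compat; lra|apply pow_lt; lra].
  - unfold Rdiv. apply Rmult_le_compat.
    + apply Rmult_le_pos; lra.
    + apply Rlt_le, Rinv_0_lt_compat, pow_lt; lra.
    + apply Rmult_le_compat_l; lra.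
    + apply Rinv_le_contravar; [apply pow_lt; lra|]. apply pow_incr; lra.
Qed.

(** Below the level [exp (-1)] the contour stays below the equilibrium, and the
    angular speed is a positive, bounded and periodic function of the angle. *)
Lemma contour_is_cycle (hbar M k delta E : R) :
  0 < hbar -> 0 < M -> 0 < k -> 0 < delta -> 0 < E < exp (-1) ->
  is_cycle (sys hbar M k delta) (contour (delta / k) E).
Proof.
  intros hh hM hk hd hE.
  assert (hm : 0 < delta / k) by now apply Rdiv_lt_0_compat.
  set (m := delta / k) in *. set (kap := hbar * k / M / m).
  assert (hkap : 0 < kap).
  { repeat apply Rdiv_lt_0_compat; trivial. now apply Rmult_lt_0_compat. }
  assert (hE' : 0 < E <= exp (-1)) by lra. assert (hPI := PI_RGT_0).
  assert (hcos : forall al, E * cos al < exp (-1)).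
  { intros al. generalize (COS_bound al); nra. }
  destruct (quadrature (angular_speed kap E) (kap * 2 / (E * exp (-1)) ^ 2))
    as (tau & al & h1 & h2 & h3 & h4 & _ & h6).
  - intros al. apply continuous_angular_speed; lra.
  - intros al. apply angular_speed_bounds; trivial.
    generalize (lambert_E_cos_bounds E al hE'); lra.
  - destruct (quadrature_periodic (angular_speed kap E) tau al (2 * PI))
      as (T & hT & hper); trivial; [lra| |].
    { intros x. unfold angular_speed. now rewrite cos_plus, cos_2PI, sin_2PI,
        Rmult_1_r, Rmult_0_r, Rminus_0_r. }
    assert (Hc := fun t => contour_contour_point m E (al t) hm hE').
    split.
    + exists (contour_point m E PI), (contour_point m E (PI / 2)).
      split; [|split]; [now apply contour_contour_point..|].
      now apply contour_nonconstant.
    + exists (fun t => contour_point m E (al t)), T.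
      split; [|split; [|split]]; trivial.
      * apply entire_maximal. intros t. split.
        -- right. eapply contour_ne_origin; [exact hm|apply hE'|apply Hc].
        -- now apply contour_point_solution with (kap := kap).
      * intros p. split.
        -- intros hp. destruct (contour_point_surj m E p hm ltac:(lra) hp) as (b & _ & <-).
           exists (tau b). split; [now split|]. now rewrite h4.
        -- intros (t & _ & <-). apply Hc.
      * intros t. rewrite hper. apply contour_point_period.
Qed.

Lemma increasing_limit_p_infty (f : R -> R) (l : R) :
  (forall t u, t < u -> f t < f u) -> (forall t, f t < l) ->
  (forall c, c < l -> exists t, c < f t) ->
  filterlim f (Rbar_locally p_infty) (locally l).
Proof.
  intros Hinc Hb Hs P [eps HP].
  destruct (Hs (l - eps)) as (t0 & h0); [generalize (cond_pos eps); lra|].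
  exists t0. intros t ht. apply HP. change (Rabs (f t - l) < eps).
  specialize (Hinc t0 t ht). specialize (Hb t). rewrite Rabs_left; lra.
Qed.

Lemma increasing_limit_m_infty (f : R -> R) (l : R) :
  (forall t u, t < u -> f t < f u) -> (forall t, l < f t) ->
  (forall c, l < c -> exists t, f t < c) ->
  filterlim f (Rbar_locally m_infty) (locally l).
Proof.
  intros Hinc Hb Hs P [eps HP].
  destruct (Hs (l + eps)) as (t0 & h0); [generalize (cond_pos eps); lra|].
  exists t0. intros t ht. apply HP. change (Rabs (f t - l) < eps).
  specialize (Hinc t t0 ht). specialize (Hb t). rewrite Rabs_right; lra.
Qed.

(** An angle running through [(0, 2 * PI)] as [s] runs through the line. Its speed
    vanishes at both ends to the first order, just as the angular speed of the
    homoclinic orbit does; their quotient is therefore bounded. *)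
Definition open_angle (s : R) : R := 4 * atan (exp s).

Lemma is_derive_open_angle (s : R) :
  is_derive open_angle s (4 * exp s / (1 + exp s ^ 2)).
Proof.
  unfold open_angle. auto_derive; trivial. unfold Rsqr.
  field. generalize (pow2_ge_0 (exp s)); lra.
Qed.

Lemma open_angle_bounds (s : R) : 0 < open_angle s < 2 * PI.
Proof.
  unfold open_angle. assert (h := atan_bound (exp s)).
  assert (h1 := atan_increasing 0 (exp s) (exp_pos s)). rewrite atan_0 in h1. lra.
Qed.

Lemma open_angle_increasing (s t : R) : s < t -> open_angle s < open_angle t.
Proof.
  intros h. apply Rmult_lt_compat_l; [lra|]. now apply atan_increasing, exp_increasing.
Qed.

Lemma open_angle_surj (al : R) : 0 < al < 2 * PI -> exists s, open_angle s = al.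
Proof.
  intros h. exists (ln (tan (al / 4))). unfold open_angle.
  rewrite exp_ln by (apply tan_gt_0; lra). rewrite atan_tan by lra. field.
Qed.

Lemma one_sub_cos_open_angle (s : R) :
  2 * (1 - cos (open_angle s)) = (4 * exp s / (1 + exp s ^ 2)) ^ 2.
Proof.
  unfold open_angle. set (w := exp s). set (be := atan w).
  replace (4 * be) with (2 * (2 * be)) by ring.
  rewrite cos_2a_sin, sin_2a. unfold be. rewrite sin_atan, cos_atan.
  assert (hw : 0 < 1 + w ^ 2) by (generalize (pow2_ge_0 w); lra).
  replace (1 + Rsqr w) with (1 + w ^ 2) by (unfold Rsqr; ring).
  assert (h : sqrt (1 + w ^ 2) ^ 2 = 1 + w ^ 2) by (apply pow2_sqrt; lra).
  assert (h0 : 0 < sqrt (1 + w ^ 2)) by now apply sqrt_lt_R0.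
  set (r := sqrt (1 + w ^ 2)) in *. rewrite <- h. field. lra.
Qed.

Lemma contour_point_0 (m : R) : contour_point m (exp (-1)) 0 = (0, m).
Proof.
  unfold contour_point. rewrite cos_0, sin_0.
  replace (exp (-1) * 1) with (1 * exp (- (1)))
    by (change (- (1)) with (-1); ring).
  rewrite lambert_unique by lra. f_equal; ring.
Qed.

(** Passing from [al] to [s] with [al = open_angle s] divides the angular speed by
    the derivative [a s] of [open_angle]. On this contour [(1 - Y) ^ 2] is at most
    [2 * (1 - cos al)], which is [(a s) ^ 2]: the quotient is bounded, and [s] moves
    over the whole line in infinite time. *)
Lemma loop_is_homoclinic (hbar M k delta : R) :
  0 < hbar -> 0 < M -> 0 < k -> 0 < delta ->
  is_homoclinic (sys hbar M k delta) (0, delta / k)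
    (fun p => contour (delta / k) (exp (-1)) p /\ p <> (0, delta / k)).
Proof.
  intros hh hM hk hd.
  assert (hm : 0 < delta / k) by now apply Rdiv_lt_0_compat.
  set (m := delta / k) in *. set (kap := hbar * k / M / m).
  assert (hkap : 0 < kap).
  { repeat apply Rdiv_lt_0_compat; trivial. now apply Rmult_lt_0_compat. }
  set (E := exp (-1)). assert (hE : 0 < E <= exp (-1)).
  { split; [apply exp_pos|unfold E; lra]. }
  assert (hPI := PI_RGT_0).
  set (a := fun s => 4 * exp s / (1 + exp s ^ 2)).
  assert (ha : forall s, 0 < a s).
  { intros s. assert (h := exp_pos s). apply Rdiv_lt_0_compat; [lra|].
    generalize (pow2_ge_0 (exp s)); lra. }
  assert (hcos : forall s, E * cos (open_angle s) < exp (-1)).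
  { intros s. assert (h := one_sub_cos_open_angle s). fold (a s) in h.
    assert (h' := pow_lt (a s) 2 (ha s)). unfold E.
    assert (0 < exp (-1)) by apply exp_pos. nra. }
  assert (hgap : forall s, 1 - lambert (E * cos (open_angle s)) <= a s).
  { intros s. apply Rnot_lt_le. intros h. specialize (ha s).
    assert (h1 := lambert_sqrt_bound (E * cos (open_angle s)) (Rlt_le _ _ (hcos s))).
    replace (exp 1 * (E * cos (open_angle s))) with (cos (open_angle s)) in h1.
    2: { unfold E. rewrite <- Rmult_assoc, <- exp_plus.
         replace (1 + -1) with 0 by ring. rewrite exp_0; ring. }
    rewrite one_sub_cos_open_angle in h1. fold (a s) in h1. nra. }
  set (f := fun s => angular_speed kap E (open_angle s) / a s).
  set (K := kap / (E * exp (-1)) ^ 2).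
  destruct (quadrature f K) as (tau & s & _ & _ & h3 & h4 & h5 & h6).
  { intros s. unfold f.
    apply (continuous_mult (K := R_AbsRing)).
    - apply (continuous_comp open_angle (angular_speed kap E)).
      + apply (ex_derive_continuous (V := R_NormedModule)).
        eexists; apply is_derive_open_angle.
      + apply continuous_angular_speed; apply hE.
    - apply (continuous_comp a Rinv).
      + apply (ex_derive_continuous (V := R_NormedModule)). unfold a. auto_derive.
        generalize (pow2_ge_0 (exp s)); lra.
      + apply (filterlim_Rbar_inv (Finite (a s))).
        intro e; injection e. specialize (ha s); lra. }
  { intros s. specialize (ha s).
    destruct (angular_speed_bounds kap E (open_angle s) (a s) hkap hE (hcos s) (hgap s))
      as [h1 h2].
    unfold f. split; [now apply Rdiv_lt_0_compat|].
    apply Rle_div_l; trivial. unfold K.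
    replace (kap / (E * exp (-1)) ^ 2 * a s) with (kap * a s / (E * exp (-1)) ^ 2);
      trivial.
    field. split; apply Rgt_not_eq; [apply exp_pos|apply hE]. }
  set (al := fun t => open_angle (s t)).
  assert (Hal : forall t, is_derive al t (angular_speed kap E (al t))).
  { intros t. unfold al.
    replace (angular_speed kap E (open_angle (s t))) with (scal (f (s t)) (a (s t))).
    - apply (is_derive_comp open_angle s); [apply is_derive_open_angle|apply h6].
    - unfold scal; simpl; unfold mult; simpl. unfold f. field.
      apply Rgt_not_eq, ha. }
  assert (Hinc : forall t u, t < u -> al t < al u)
    by (intros; now apply open_angle_increasing, h5).
  assert (Hsurj : forall b, 0 < b < 2 * PI -> exists t, al t = b).
  { intros b hb. destruct (open_angle_surj b hb) as (x & <-). exists (tau x).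
    unfold al. now rewrite h4. }
  assert (Hb : forall t, 0 < al t < 2 * PI) by (intros t; apply open_angle_bounds).
  assert (He : forall b, 0 < b < 2 * PI -> contour_point m E b <> (0, m)).
  { intros b hb e. rewrite <- contour_point_0 in e. fold E in e.
    apply contour_point_inj in e; trivial; lra. }
  set (g := fun t => contour_point m E (al t)).
  assert (Hmax : maximal_solution (sys hbar M k delta) m_infty p_infty g).
  { apply entire_maximal. intros t. split.
    - right. apply (contour_ne_origin m E); [exact hm|apply hE|].
      now apply contour_contour_point.
    - apply contour_point_solution with (kap := kap); trivial. apply hcos. }
  assert (Htr : is_trace m_infty p_infty g (fun p => contour m E p /\ p <> (0, m))).
  { intros p. split.
    - intros [hp hpe].
      destruct (contour_point_surj m E p hm (proj1 hE) hp) as (b & hb & <-).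
      destruct (Hsurj b) as (t & <-).
      + split; [|lra]. destruct (proj1 hb) as [h| <-]; trivial.
        now rewrite contour_point_0 in hpe.
      + exists t. now split.
    - intros (t & _ & <-). split; [now apply contour_contour_point|].
      apply He, Hb. }
  assert (Hlim : forall F : (R -> Prop) -> Prop, forall b, contour_point m E b = (0, m) ->
            filterlim al F (locally b) -> filterlim g F (locally ((0, m) : plane))).
  { intros F b <- h. apply (filterlim_comp _ _ _ al (contour_point m E) _ _ _ h).
    apply continuous_contour_point. }
  split; [|split; [|split]].
  - exists m_infty, p_infty, g. now split.
  - exists (contour_point m E PI), (contour_point m E (PI / 2)).
    split; [|split]; [split; [now apply contour_contour_point|apply He; lra]..|].
    now apply contour_nonconstant.
  - exists m_infty, g. split; [|split]; trivial.
    apply (Hlim _ (2 * PI)).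
    + replace (2 * PI) with (0 + 2 * PI) by ring.
      rewrite contour_point_period. apply contour_point_0.
    + apply increasing_limit_p_infty; trivial; [apply Hb|].
      intros c hc. destruct (Hsurj ((Rmax c 0 + 2 * PI) / 2)) as (t & ht).
      * assert (Rmax c 0 < 2 * PI) by (apply Rmax_lub_lt; lra).
        generalize (Rmax_r c 0); lra.
      * exists t. rewrite ht. assert (h := Rmax_l c 0).
        assert (Rmax c 0 < 2 * PI) by (apply Rmax_lub_lt; lra). lra.
  - exists p_infty, g. split; [|split]; trivial.
    apply (Hlim _ 0); [apply contour_point_0|].
    apply increasing_limit_m_infty; trivial; [apply Hb|].
    intros c hc. destruct (Hsurj (Rmin c PI / 2)) as (t & ht).
    + assert (0 < Rmin c PI) by (apply Rmin_glb_lt; lra).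
      generalize (Rmin_r c PI); lra.
    + exists t. rewrite ht. assert (h := Rmin_l c PI).
      assert (0 < Rmin c PI) by (apply Rmin_glb_lt; lra). lra.
Qed.

(** * The Hamiltonian and the linearization *)

(** Regularity of class C^2 from explicit partial derivatives on an open domain; the
    openness lets the iterated [Derive] be replaced by these locally. *)
Lemma ex_diff_2_intro (D : R -> R -> Prop) (f fx fy fxx fxy fyx fyy : R -> R -> R) :
  (forall x y, D x y -> locally_2d D x y) ->
  (forall x y, D x y -> continuity_2d_pt f x y) ->
  (forall x y, D x y -> continuity_2d_pt fx x y /\ continuity_2d_pt fy x y) ->
  (forall x y, D x y -> continuity_2d_pt fxx x y /\ continuity_2d_pt fxy x y) ->
  (forall x y, D x y -> continuity_2d_pt fyx x y /\ continuity_2d_pt fyy x y) ->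
  (forall x y, D x y -> is_derive (fun u => f u y) x (fx x y) /\
                        is_derive (fun v => f x v) y (fy x y)) ->
  (forall x y, D x y -> is_derive (fun u => fx u y) x (fxx x y) /\
                        is_derive (fun v => fx x v) y (fxy x y)) ->
  (forall x y, D x y -> is_derive (fun u => fy u y) x (fyx x y) /\
                        is_derive (fun v => fy x v) y (fyy x y)) ->
  forall x y, D x y -> ex_diff_n f 2 x y.
Proof.
  intros HD Cf C1 Cx Cy Df Dx Dy.
  assert (W : forall g gx gy : R -> R -> R,
    (forall x y, D x y -> continuity_2d_pt g x y) ->
    (forall x y, D x y -> continuity_2d_pt gx x y /\ continuity_2d_pt gy x y) ->
    (forall x y, D x y -> is_derive (fun u => g u y) x (gx x y) /\
                          is_derive (fun v => g x v) y (gy x y)) ->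
    forall x y, D x y -> ex_diff_n g 1 x y).
  { intros g gx gy Hg Hc Hd x y h.
    destruct (Hd x y h) as [d1 d2]. destruct (Hc x y h) as [c1 c2].
    split; [auto|split; [now eexists; exact d1|split; [now eexists; exact d2|split]]];
      (split; [|exact I]).
    - apply continuity_2d_pt_ext_loc with (2 := c1).
      apply locally_2d_impl with (2 := HD x y h). apply locally_2d_forall.
      intros u v huv. symmetry. apply is_derive_unique, Hd, huv.
    - apply continuity_2d_pt_ext_loc with (2 := c2).
      apply locally_2d_impl with (2 := HD x y h). apply locally_2d_forall.
      intros u v huv. symmetry. apply is_derive_unique, Hd, huv. }
  intros x y h. destruct (Df x y h) as [d1 d2].
  split; [auto|split; [now eexists; exact d1|split; [now eexists; exact d2|split]]].
  - apply ex_diff_n_ext_loc with fx.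
    + apply locally_2d_impl with (2 := HD x y h). apply locally_2d_forall.
      intros u v huv. symmetry. apply is_derive_unique, Df, huv.
    + apply (W fx fxx fxy); trivial. apply C1.
  - apply ex_diff_n_ext_loc with fy.
    + apply locally_2d_impl with (2 := HD x y h). apply locally_2d_forall.
      intros u v huv. symmetry. apply is_derive_unique, Df, huv.
    + apply (W fy fyx fyy); trivial. apply C1.
Qed.

Lemma sqr_norm_pos (x y : R) : (x, y) <> (0, 0) -> 0 < x ^ 2 + y ^ 2.
Proof.
  intros h. assert (h1 := radius_pos (x, y) h).
  assert (h2 := radius_sqr (x, y)). simpl fst in h2; simpl snd in h2.
  rewrite <- h2. now apply pow_lt.
Qed.

Lemma sqr_norm_pos_open (x y : R) :
  0 < x ^ 2 + y ^ 2 -> locally_2d (fun u v => 0 < u ^ 2 + v ^ 2) x y.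
Proof.
  intros h. apply locally_2d_locally.
  apply (open_comp (T := prod_UniformSpace R_UniformSpace R_UniformSpace)
    (fun p : plane => fst p ^ 2 + snd p ^ 2) (fun r => 0 < r)); [|apply open_gt|exact h].
  intros p _. apply continuous_sqr_norm.
Qed.

Lemma open_punctured_plane : open (fun p : plane => p <> (0, 0)).
Proof.
  apply (open_ext (T := prod_UniformSpace R_UniformSpace R_UniformSpace)
           (fun p => 0 < radius p)).
  - intros p. split.
    + intros h ->. unfold radius in h; simpl fst in h; simpl snd in h.
      replace (0 ^ 2 + 0 ^ 2) with 0 in h by ring. rewrite sqrt_0 in h. lra.
    + apply radius_pos.
  - apply (open_comp (T := prod_UniformSpace R_UniformSpace R_UniformSpace) radius
             (fun r => 0 < r)); [|apply open_gt].
    intros p _. apply continuous_radius.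
Qed.

Ltac continuity_2d_rational :=
  repeat first
    [ apply continuity_2d_pt_const | apply continuity_2d_pt_id1
    | apply continuity_2d_pt_id2 | apply continuity_2d_pt_minus
    | apply continuity_2d_pt_plus | apply continuity_2d_pt_opp
    | apply continuity_2d_pt_mult | apply continuity_2d_pt_inv ].

Lemma Ham_derive_x (hbar M k delta x y : R) : 0 < x ^ 2 + y ^ 2 ->
  is_derive (fun u => Ham hbar M k u y delta) x
    (hbar * k / M * (delta / k * (x / (x ^ 2 + y ^ 2)))).
Proof.
  intros h. unfold Ham. assert (h0 := sqrt_lt_R0 _ h).
  assert (hs : sqrt (x ^ 2 + y ^ 2) ^ 2 = x ^ 2 + y ^ 2) by (apply pow2_sqrt; lra).
  auto_derive; [now repeat split|].
  simpl in h0, hs |- *. rewrite !Rmult_1_r in *.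
  set (c := hbar * k / M). set (m := delta / k).
  set (r := sqrt (x * x + y * y)) in *. rewrite <- hs. field. lra.
Qed.

Lemma Ham_derive_y (hbar M k delta x y : R) : 0 < x ^ 2 + y ^ 2 ->
  is_derive (fun v => Ham hbar M k x v delta) y
    (hbar * k / M * (-1 + delta / k * (y / (x ^ 2 + y ^ 2)))).
Proof.
  intros h. unfold Ham. assert (h0 := sqrt_lt_R0 _ h).
  assert (hs : sqrt (x ^ 2 + y ^ 2) ^ 2 = x ^ 2 + y ^ 2) by (apply pow2_sqrt; lra).
  auto_derive; [now repeat split|].
  simpl in h0, hs |- *. rewrite !Rmult_1_r in *.
  set (c := hbar * k / M). set (m := delta / k).
  set (r := sqrt (x * x + y * y)) in *. rewrite <- hs. field. lra.
Qed.

Lemma continuity_2d_Ham (hbar M k delta x y : R) : 0 < x ^ 2 + y ^ 2 ->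
  continuity_2d_pt (fun x y => Ham hbar M k x y delta) x y.
Proof.
  intros h. unfold Ham. continuity_2d_rational.
  apply (continuity_1d_2d_pt_comp (fun r => ln (sqrt r)) (fun x y => x ^ 2 + y ^ 2)).
  - apply continuity_pt_filterlim.
    apply (ex_derive_continuous (V := R_NormedModule) (fun r => ln (sqrt r))).
    auto_derive. split; [exact h|split; [now apply sqrt_lt_R0|exact I]].
  - simpl. continuity_2d_rational.
Qed.

Lemma Ham_delta_0 (hbar M k x y : R) : Ham hbar M k x y 0 = - (hbar * k / M) * y.
Proof. unfold Ham. unfold Rdiv at 2. ring. Qed.

Lemma sys_hamiltonian (hbar M k delta : R) :
  0 <= delta -> is_hamiltonian (sys hbar M k delta) (fun x y => Ham hbar M k x y delta).
Proof.
  intros [hd|<-].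
  - set (c := hbar * k / M). set (m := delta / k). split.
    + apply (open_ext (T := prod_UniformSpace R_UniformSpace R_UniformSpace)
               (fun p : plane => p <> (0, 0))); [|apply open_punctured_plane].
      intros p. unfold dom, sys, sys_dom. split; [now right|].
      intros [e|e]; [lra|trivial].
    + intros x y [e|e]; [lra|]. apply sqr_norm_pos in e. split.
      * apply (ex_diff_2_intro (fun x y => 0 < x ^ 2 + y ^ 2)
          (fun x y => Ham hbar M k x y delta)
          (fun x y => c * (m * (x / (x ^ 2 + y ^ 2))))
          (fun x y => c * (-1 + m * (y / (x ^ 2 + y ^ 2))))
          (fun x y => c * (m * ((y ^ 2 - x ^ 2) / (x ^ 2 + y ^ 2) ^ 2)))
          (fun x y => - c * (m * (2 * x * y / (x ^ 2 + y ^ 2) ^ 2)))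
          (fun x y => - c * (m * (2 * x * y / (x ^ 2 + y ^ 2) ^ 2)))
          (fun x y => c * (m * ((x ^ 2 - y ^ 2) / (x ^ 2 + y ^ 2) ^ 2)))); trivial;
          clear x y e; intros x y e.
        -- now apply sqr_norm_pos_open.
        -- now apply continuity_2d_Ham.
        -- simpl in *. unfold Rdiv. split; continuity_2d_rational; lra.
        -- simpl in *. unfold Rdiv. split; continuity_2d_rational; nra.
        -- simpl in *. unfold Rdiv. split; continuity_2d_rational; nra.
        -- split; [now apply Ham_derive_x|now apply Ham_derive_y].
        -- split; auto_derive; try lra; field; lra.
        -- split; auto_derive; try lra; field; lra.
      * cbn [field sys sys_field].
        f_equal.
        -- symmetry. now apply is_derive_unique, Ham_derive_y.
        -- rewrite Ropp_mult_distr_l_reverse. f_equal.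
           symmetry. now apply is_derive_unique, Ham_derive_x.
  - assert (D1 : forall c x y : R, is_derive (fun _ : R => - c * y) x 0 /\
                                   is_derive (fun v : R => - c * v) y (- c)).
    { intros c x y. split; auto_derive; trivial; ring. }
    assert (D0 : forall c x y : R, is_derive (fun _ : R => c) x 0 /\
                                   is_derive (fun _ : R => c) y 0).
    { intros c x y. split; auto_derive; trivial. }
    set (c := hbar * k / M). split.
    + apply (open_ext (T := prod_UniformSpace R_UniformSpace R_UniformSpace)
               (fun _ => True)); [|apply open_true].
      intros p. split; [now left|trivial].
    + intros x y _. split.
      * apply ex_diff_n_ext_loc with (fun _ y => - c * y).
        { apply locally_2d_forall. intros u v. now rewrite Ham_delta_0. }
        apply (ex_diff_2_intro (fun _ _ => True) _ (fun _ _ => 0) (fun _ _ => - c)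
          (fun _ _ => 0) (fun _ _ => 0) (fun _ _ => 0) (fun _ _ => 0));
          [intros u v _..|exact I].
        -- now apply locally_2d_forall.
        -- continuity_2d_rational.
        -- split; continuity_2d_rational.
        -- split; continuity_2d_rational.
        -- split; continuity_2d_rational.
        -- apply D1.
        -- apply D0.
        -- apply D0.
      * cbn [field sys sys_field].
        rewrite (Derive_ext _ (fun v => - c * v)) by (intros; apply Ham_delta_0).
        rewrite (Derive_ext (fun u => Ham hbar M k u y 0) (fun _ => - c * y))
          by (intros; apply Ham_delta_0).
        replace (Derive (fun v : R => - c * v) y) with (- c)
          by (symmetry; apply is_derive_unique, (D1 c x y)).
        replace (Derive (fun _ : R => - c * y) x) with 0
          by (symmetry; apply is_derive_unique, (D1 c x y)).
        fold c. replace (0 / k) with 0 by (unfold Rdiv; ring). f_equal; ring.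
Qed.

Lemma Ham_constant (hbar M k delta : R) (a b : Rbar) (g : R -> plane) :
  0 < delta -> solution (sys hbar M k delta) a b g ->
  forall s t, in_itv a b s -> in_itv a b t ->
  Ham hbar M k (fst (g s)) (snd (g s)) delta = Ham hbar M k (fst (g t)) (snd (g t)) delta.
Proof.
  intros hd [_ H].
  apply (is_derive_zero_const a b (fun t => Ham hbar M k (fst (g t)) (snd (g t)) delta)).
  intros t ht. destruct (H t ht) as [[e|e] Hg]; [lra|].
  assert (Hx := is_derive_fst _ _ _ Hg). assert (Hy := is_derive_snd _ _ _ Hg).
  set (x := fun s => fst (g s)) in *. set (y := fun s => snd (g s)) in *.
  assert (Hp : 0 < x t ^ 2 + y t ^ 2).
  { apply sqr_norm_pos. unfold x, y. now rewrite <- surjective_pairing. }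
  assert (Hf : field (sys hbar M k delta) (g t) = sys_field hbar M k delta (x t, y t)).
  { unfold x, y. now rewrite <- surjective_pairing. }
  rewrite Hf in Hx, Hy. cbn [sys_field fst snd] in Hx, Hy. clear Hf Hg.
  change (is_derive (fun s => Ham hbar M k (x s) (y s) delta) t 0).
  unfold Ham. assert (h0 := sqrt_lt_R0 _ Hp).
  assert (hs : sqrt (x t ^ 2 + y t ^ 2) ^ 2 = x t ^ 2 + y t ^ 2)
    by (apply pow2_sqrt; lra).
  auto_derive.
  { repeat split; trivial; eexists; [exact Hx|exact Hy|exact Hy]. }
  rewrite (is_derive_unique (fun s : R => x s) t _ Hx : Derive (fun s : R => x s) t = _),
    (is_derive_unique (fun s : R => y s) t _ Hy : Derive (fun s : R => y s) t = _).
  simpl in h0, hs |- *. rewrite !Rmult_1_r in *.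
  set (c := hbar * k / M). set (m := delta / k).
  set (r := sqrt (x t * x t + y t * y t)) in *.
  rewrite <- hs. field. lra.
Qed.

Lemma filterdiff_off_origin (f fx : R -> R -> R) (x y fy : R) :
  0 < x ^ 2 + y ^ 2 ->
  (forall u v, 0 < u ^ 2 + v ^ 2 -> is_derive (fun z => f z v) u (fx u v)) ->
  is_derive (fun v => f x v) y fy ->
  continuity_2d_pt fx x y ->
  filterdiff (fun p : plane => f (fst p) (snd p)) (locally ((x, y) : plane))
    (fun p : plane => fst p * fx x y + snd p * fy).
Proof.
  intros h H1 H2 H3.
  apply (is_derive_filterdiff f x y fx fy).
  - apply filter_imp with (P := fun p : plane => 0 < fst p ^ 2 + snd p ^ 2).
    + intros p hp. now apply H1.
    + apply (proj1 (locally_2d_locally (fun u v => 0 < u ^ 2 + v ^ 2) x y)).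
      now apply sqr_norm_pos_open.
  - exact H2.
  - now apply continuity_2d_pt_filterlim.
Qed.

Lemma filterdiff_field_equilibrium (hbar M k delta : R) :
  0 < hbar -> 0 < M -> 0 < k -> 0 < delta ->
  filterdiff (K := R_AbsRing) (field (sys hbar M k delta))
    (locally ((0, delta / k) : plane))
    (fun p : plane => (- (hbar * k / M / (delta / k)) * snd p,
                       - (hbar * k / M / (delta / k)) * fst p) : plane).
Proof.
  intros hh hM hk hd.
  set (c := hbar * k / M). set (m := delta / k).
  assert (hm : 0 < m) by now apply Rdiv_lt_0_compat.
  assert (hp : 0 < 0 ^ 2 + m ^ 2) by nra.
  apply (filterdiff_ext (fun p : plane =>
    (c * (-1 + m * (snd p / (fst p ^ 2 + snd p ^ 2))),
     - c * (m * (fst p / (fst p ^ 2 + snd p ^ 2)))) : plane)).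
  { intros [x y]. reflexivity. }
  apply (filterdiff_comp'_2 (K := R_AbsRing)
    (fun p : plane => c * (-1 + m * (snd p / (fst p ^ 2 + snd p ^ 2))))
    (fun p : plane => - c * (m * (fst p / (fst p ^ 2 + snd p ^ 2))))
    (fun a b => (a, b) : plane) ((0, m) : plane)
    (fun p : plane => - (c / m) * snd p) (fun p : plane => - (c / m) * fst p)
    (fun a b => (a, b) : plane)).
  - apply (filterdiff_ext_lin _ (fun p : plane =>
      fst p * (- c * (m * (2 * 0 * m / (0 ^ 2 + m ^ 2) ^ 2))) + snd p * (- (c / m)))).
    2: { intros p. match goal with |- @eq _ ?a ?b => change (@eq R a b) end.
         field. repeat split; nra. }
    apply (filterdiff_off_origin (fun x y => c * (-1 + m * (y / (x ^ 2 + y ^ 2))))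
      (fun x y => - c * (m * (2 * x * y / (x ^ 2 + y ^ 2) ^ 2)))); trivial.
    + intros u v h. auto_derive; [lra|]. field; lra.
    + auto_derive; [lra|]. field. lra.
    + simpl in *. unfold Rdiv. continuity_2d_rational; nra.
  - apply (filterdiff_ext_lin _ (fun p : plane =>
      fst p * (c * (m * ((0 ^ 2 - m ^ 2) / (0 ^ 2 + m ^ 2) ^ 2))) + snd p * 0)).
    2: { intros p. match goal with |- @eq _ ?a ?b => change (@eq R a b) end.
         field. repeat split; nra. }
    apply (filterdiff_off_origin (fun x y => - c * (m * (x / (x ^ 2 + y ^ 2))))
      (fun x y => c * (m * ((x ^ 2 - y ^ 2) / (x ^ 2 + y ^ 2) ^ 2)))); trivial.
    + intros u v h. auto_derive; [lra|]. field; lra.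
    + auto_derive; [lra|]. field. lra.
    + simpl in *. unfold Rdiv. continuity_2d_rational; nra.
  - apply filterdiff_linear, is_linear_prod.
    + apply is_linear_fst.
    + apply is_linear_snd.
Qed.

(** * The uniform flow *)

Lemma itv_point (a b : Rbar) : Rbar_lt a b -> exists t, in_itv a b t.
Proof.
  destruct a as [a| |], b as [b| |]; simpl; intros h; try contradiction.
  - exists ((a + b) / 2). split; simpl; lra.
  - exists (a + 1). split; simpl; trivial; lra.
  - exists (b - 1). split; simpl; trivial; lra.
  - exists 0. now split.
Qed.

Lemma uniform_orbit_iff (hbar M k : R) (O : plane -> Prop) :
  0 < hbar -> 0 < M -> 0 < k ->
  is_orbit (sys hbar M k 0) O <-> exists c0, forall p, O p <-> snd p = c0.
Proof.
  intros hh hM hk. set (c := hbar * k / M).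
  assert (hc : 0 < c) by (apply Rdiv_lt_0_compat; [now apply Rmult_lt_0_compat|trivial]).
  assert (Hf : forall p, field (sys hbar M k 0) p = (- c, 0)).
  { intros [x y]. simpl. fold c. replace (0 / k) with 0 by (unfold Rdiv; ring).
    f_equal; ring. }
  assert (Hline : forall x0 y0 t0 t, is_derive (fun t => (x0 - c * (t - t0), y0) : plane) t
            (field (sys hbar M k 0) (x0 - c * (t - t0), y0))).
  { intros x0 y0 t0 t. rewrite Hf.
    apply is_derive_pair; auto_derive; trivial; ring. }
  assert (Hent : forall x0 y0 t0, maximal_solution (sys hbar M k 0) m_infty p_infty
            (fun t => (x0 - c * (t - t0), y0))).
  { intros x0 y0 t0. apply entire_maximal. intros t. split; [now left|apply Hline]. }
  assert (Htr : forall (x0 y0 t0 : R) (p : plane), snd p = y0 <->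
            exists t, in_itv m_infty p_infty t /\ (x0 - c * (t - t0), y0) = p).
  { intros x0 y0 t0 [x y]; cbn [snd]. split.
    - intros ->. exists (t0 - (x - x0) / c). split; [now split|].
      f_equal. field. lra.
    - intros (t & _ & e). now injection e. }
  split.
  - intros (a & b & g & [[hab Hg] Hmax] & HO).
    destruct (itv_point a b hab) as (t0 & ht0).
    set (x0 := fst (g t0)). set (y0 := snd (g t0)).
    assert (Hx : forall t, in_itv a b t -> (x0 - c * (t - t0), y0) = g t).
    { intros t ht. rewrite (surjective_pairing (g t)). f_equal.
      - assert (E : fst (g t) + c * t = fst (g t0) + c * t0).
        { apply (is_derive_zero_const a b (fun t => fst (g t) + c * t)); trivial.
          clear t ht. intros t ht. destruct (Hg t ht) as [_ h]. rewrite Hf in h.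
          apply is_derive_fst in h. cbn [fst] in h.
          replace 0 with (plus (- c) c) by apply (Rplus_opp_l c).
          apply (is_derive_plus (fun s => fst (g s)) (fun s => c * s)); trivial.
          auto_derive; trivial; ring. }
        unfold x0. lra.
      - apply (is_derive_zero_const a b (fun t => snd (g t))); trivial.
        clear t ht. intros t ht. destruct (Hg t ht) as [_ h]. rewrite Hf in h.
        now apply is_derive_snd in h. }
    destruct (Hmax m_infty p_infty _ (proj1 (Hent x0 y0 t0))) as [<- <-];
      [exact I|now destruct b|exact Hx|].
    exists y0. intros p. rewrite (Htr x0 y0 t0 p), (HO p).
    split; intros (t & ht & e); exists t; (split; [trivial|]);
      rewrite <- e; [|symmetry]; now rewrite <- Hx.
  - intros (y0 & HO). exists m_infty, p_infty, (fun t => (0 - c * (t - 0), y0)).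
    split; [apply Hent|]. intros p. rewrite HO. apply Htr.
Qed.

(** * Level curves and symmetry *)

(** Reflection in the [y]-axis combined with reversal of time. *)
Definition reversed (g : R -> plane) : R -> plane :=
  fun t => (- fst (g (- t)), snd (g (- t))).

Lemma reversed_involutive (g : R -> plane) (t : R) : reversed (reversed g) t = g t.
Proof.
  unfold reversed; cbn [fst snd]. rewrite !Ropp_involutive.
  symmetry; apply surjective_pairing.
Qed.

Lemma in_itv_opp (a b : Rbar) (t : R) :
  in_itv (Rbar_opp b) (Rbar_opp a) t <-> in_itv a b (- t).
Proof.
  unfold in_itv. destruct a as [a| |], b as [b| |]; simpl;
    split; intros [h1 h2]; split; trivial; try contradiction; lra.
Qed.

Lemma reversed_solution (hbar M k delta : R) (a b : Rbar) (g : R -> plane) :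
  0 < delta -> solution (sys hbar M k delta) a b g ->
  solution (sys hbar M k delta) (Rbar_opp b) (Rbar_opp a) (reversed g).
Proof.
  intros hd [hab H]. split; [now apply Rbar_opp_lt|].
  intros t ht. apply in_itv_opp in ht. destruct (H _ ht) as [[e|e] Hd]; [lra|].
  split.
  - right. unfold reversed. intros e'. apply e. injection e' as e1 e2.
    rewrite (surjective_pairing (g (- t))). f_equal; lra.
  - assert (Hx := is_derive_fst _ _ _ Hd). assert (Hy := is_derive_snd _ _ _ Hd).
    assert (Hopp : is_derive Ropp t (-1)) by (auto_derive; trivial; ring).
    unfold reversed. destruct (g (- t)) as [x y] eqn:Eg.
    cbn [field sys sys_field fst snd] in *.
    replace ((- x) ^ 2) with (x ^ 2) by ring.
    apply is_derive_pair.
    + match goal with |- is_derive _ _ ?v =>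
        replace v with (opp (scal (-1) v))
          by (unfold opp, scal; simpl; unfold mult; simpl; ring) end.
      apply (is_derive_opp (fun s => fst (g (- s)))).
      apply (is_derive_comp (fun s => fst (g s)) Ropp); trivial.
    + replace (- (hbar * k / M) * (delta / k * (- x / (x ^ 2 + y ^ 2))))
        with (scal (-1) (- (hbar * k / M) * (delta / k * (x / (x ^ 2 + y ^ 2)))))
        by (unfold scal; simpl; unfold mult; simpl; unfold Rdiv; ring).
      apply (is_derive_comp (fun s => snd (g s)) Ropp); trivial.
Qed.

(** A solution extending the reversed one reverses to an extension of the original
    one, which is how maximality is inherited. *)
Lemma reflected_orbit (hbar M k delta : R) (O : plane -> Prop) :
  0 < delta -> is_orbit (sys hbar M k delta) O ->
  is_orbit (sys hbar M k delta) (reflect_y_axis O).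
Proof.
  intros hd (a & b & g & [Hg Hmax] & HO).
  exists (Rbar_opp b), (Rbar_opp a), (reversed g). split; [split|].
  - now apply reversed_solution.
  - intros a' b' g' Hg' ha hb Heq.
    apply reversed_solution in Hg'; trivial.
    destruct (Hmax _ _ _ Hg') as [<- <-].
    + apply Rbar_opp_le. now rewrite Rbar_opp_involutive.
    + apply Rbar_opp_le. now rewrite Rbar_opp_involutive.
    + intros t ht. rewrite <- (reversed_involutive g t).
      unfold reversed at 1 2. rewrite Heq; trivial.
      apply in_itv_opp. now rewrite Ropp_involutive.
    + now rewrite !Rbar_opp_involutive.
  - intros p. unfold reflect_y_axis. rewrite (HO _).
    split; intros (t & ht & e).
    + exists (- t). split; [apply in_itv_opp; now rewrite Ropp_involutive|].
      unfold reversed. rewrite Ropp_involutive, e. cbn [fst snd].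
      rewrite Ropp_involutive. symmetry; apply surjective_pairing.
    + exists (- t). apply in_itv_opp in ht. split; trivial.
      rewrite <- e. unfold reversed; cbn [fst snd]. rewrite Ropp_involutive.
      apply surjective_pairing.
Qed.

Lemma Ham_equilibrium (hbar M k delta : R) : 0 < k -> 0 < M -> 0 < delta ->
  Ham hbar M k 0 (delta / k) delta = hbar * delta / M * (ln (delta / k) - 1).
Proof.
  intros hk hM hd. assert (hm : 0 < delta / k) by now apply Rdiv_lt_0_compat.
  unfold Ham. replace (0 ^ 2 + (delta / k) ^ 2) with ((delta / k) ^ 2) by ring.
  rewrite sqrt_pow2 by lra. field. lra.
Qed.

Lemma continuous_Ham (hbar M k delta : R) (p : plane) : p <> (0, 0) ->
  continuous (fun q : plane => Ham hbar M k (fst q) (snd q) delta) p.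
Proof.
  destruct p as [x y]. intros h.
  apply (proj1 (continuity_2d_pt_filterlim
                  (fun x y => Ham hbar M k x y delta) x y)).
  now apply continuity_2d_Ham, sqr_norm_pos.
Qed.

(** A solution that tends to a point within the domain lies on the level of that
    point; the filter [F] stands for either end of the interval. *)
Lemma Ham_limit (hbar M k delta : R) (a b : Rbar) (g : R -> plane) (e : plane)
  (F : (R -> Prop) -> Prop) (t : R) :
  0 < delta -> solution (sys hbar M k delta) a b g -> e <> (0, 0) ->
  ProperFilter F -> F (in_itv a b) -> filterlim g F (locally e) -> in_itv a b t ->
  Ham hbar M k (fst (g t)) (snd (g t)) delta = Ham hbar M k (fst e) (snd e) delta.
Proof.
  intros hd Hg he HF Hin Hlim ht.
  apply (filterlim_locally_unique (V := R_NormedModule) (F := F)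
           (fun s => Ham hbar M k (fst (g s)) (snd (g s)) delta)).
  - apply (filterlim_ext_loc
      (fun _ => Ham hbar M k (fst (g t)) (snd (g t)) delta)); [|apply filterlim_const].
    apply filter_imp with (2 := Hin). intros s hs.
    now apply (Ham_constant hbar M k delta a b g).
  - apply (filterlim_comp _ _ _ g (fun q : plane => Ham hbar M k (fst q) (snd q) delta)
             _ _ _ Hlim).
    now apply continuous_Ham.
Qed.

Lemma orbit_ne_origin (hbar M k delta : R) (a b : Rbar) (g : R -> plane) (t : R) :
  0 < delta -> solution (sys hbar M k delta) a b g -> in_itv a b t -> g t <> (0, 0).
Proof. intros hd [_ H] ht. destruct (H t ht) as [[e|e] _]; [lra|trivial]. Qed.

Lemma separatrix_in_L (hbar M k delta : R) (O : plane -> Prop) (p : plane) :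
  0 < M -> 0 < k -> 0 < delta ->
  is_separatrix (sys hbar M k delta) (0, delta / k) O -> O p -> L hbar M k delta p.
Proof.
  intros hM hk hd (_ & _ & H) Hp.
  assert (he : ((0, delta / k) : plane) <> (0, 0)).
  { assert (0 < delta / k) by now apply Rdiv_lt_0_compat.
    intros e. injection e. lra. }
  assert (W : forall a b g (F : (R -> Prop) -> Prop),
    maximal_solution (sys hbar M k delta) a b g -> is_trace a b g O ->
    ProperFilter F -> F (in_itv a b) ->
    filterlim g F (locally ((0, delta / k) : plane)) -> L hbar M k delta p).
  { intros a b g F [Hg _] HO HF Hin Hlim.
    destruct (proj1 (HO p) Hp) as (t & ht & <-). split.
    - now apply (orbit_ne_origin hbar M k delta a b).
    - rewrite <- Ham_equilibrium by trivial.
      now apply (Ham_limit hbar M k delta a b g (0, delta / k) F). }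
  destruct H as [(a & g & Hmax & HO & Hlim)|(b & g & Hmax & HO & Hlim)].
  - apply (W a p_infty g (Rbar_locally p_infty)); trivial.
    + apply Rbar_locally_filter.
    + destruct Hmax as [[h _] _]. destruct (itv_point _ _ h) as (t & ht & _).
      exists t. intros s hs. split; [|exact I].
      now apply Rbar_lt_trans with (Finite t).
  - apply (W m_infty b g (Rbar_locally m_infty)); trivial.
    + apply Rbar_locally_filter.
    + destruct Hmax as [[h _] _]. destruct (itv_point _ _ h) as (t & _ & ht).
      exists t. intros s hs. split; [exact I|].
      now apply Rbar_lt_trans with (Finite t).
Qed.

Lemma equilibrium_iff (hbar M k delta : R) (p : plane) :
  0 < hbar -> 0 < M -> 0 < k -> 0 < delta ->
  is_equilibrium (sys hbar M k delta) p <-> p = (0, delta / k).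
Proof.
  intros hh hM hk hd. assert (hm : 0 < delta / k) by now apply Rdiv_lt_0_compat.
  assert (hc : 0 < hbar * k / M)
    by (apply Rdiv_lt_0_compat; [now apply Rmult_lt_0_compat|trivial]).
  destruct p as [x y]. unfold is_equilibrium; cbn [dom field sys sys_field].
  set (m := delta / k) in *. set (c := hbar * k / M) in *. split.
  - intros [[e|e] H]; [lra|].
    assert (h1 := f_equal fst H). assert (h2 := f_equal snd H). cbn [fst snd] in h1, h2.
    apply sqr_norm_pos in e. set (N := x ^ 2 + y ^ 2) in *.
    assert (hx : x = 0).
    { apply (Rmult_eq_reg_l (- c * m / N)).
      - transitivity (- c * (m * (x / N))); [field; lra|rewrite h2; ring].
      - assert (0 < c * m / N)
          by (apply Rdiv_lt_0_compat; [now apply Rmult_lt_0_compat|trivial]).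
        replace (- c * m / N) with (- (c * m / N)) by (field; lra). lra. }
    apply Rmult_integral in h1. destruct h1 as [h1|h1]; [lra|].
    assert (h3 : m * y = N).
    { apply (Rmult_eq_reg_r (/ N)); [|apply Rinv_neq_0_compat; lra].
      rewrite Rinv_r by lra. lra. }
    unfold N in h3, e. rewrite hx in *. f_equal.
    apply (Rmult_eq_reg_l y); nra.
  - intros E. injection E as -> ->. split.
    + right. intros e. injection e. lra.
    + f_equal; field; repeat split; nra.
Qed.

(** * Phase portraits *)

Theorem theorem4p1 (hbar M k delta : R)
  (hbar_pos : 0 < hbar) (M_pos : 0 < M) (k_pos : 0 < k)
  (delta_range : 0 <= delta <= 1 / 2) :
  let S := sys hbar M k delta in
  is_hamiltonian S (fun x y => Ham hbar M k x y delta) /\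
  (delta = 0 ->
    (forall O : plane -> Prop,
       is_orbit S O <-> exists c0 : R, forall p, O p <-> snd p = c0) /\
    (forall a b g, maximal_solution S a b g ->
       forall t, in_itv a b t ->
       is_derive g t ((- (hbar * k / M), 0) : plane))) /\
  (0 < delta ->
    let e : plane := (0, delta / k) in
    (forall O, is_orbit S O ->
       exists c, forall p, O p -> level_curve hbar M k delta c p) /\
    (forall O, is_orbit S O -> is_orbit S (reflect_y_axis O)) /\
    (forall p, is_equilibrium S p <-> p = e) /\
    is_saddle S e /\
    (forall O, is_separatrix S e O -> forall p, O p -> L hbar M k delta p) /\
    (exists O U : plane -> Prop,
       is_homoclinic S e O /\
       is_closed_curve (fun p => O p \/ p = e) /\
       bounds (fun p => O p \/ p = e) U /\
       U (0, 0) /\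
       (forall q, U q -> q <> (0, 0) ->
          exists Q, is_cycle S Q /\ Q q /\
            (forall p, Q p -> U p) /\ surrounds Q (0, 0)))).
Proof.
  intros S. split; [now apply sys_hamiltonian|split].
  { intros hd. unfold S. rewrite hd. split.
    - intros O. now apply uniform_orbit_iff.
    - intros a b g [[_ H] _] t ht. destruct (H t ht) as [_ h].
      destruct (g t) as [x y]. cbn [field sys sys_field] in h.
      replace (- (hbar * k / M))
        with (hbar * k / M * (-1 + 0 / k * (y / (x ^ 2 + y ^ 2))))
        by (unfold Rdiv at 2; ring).
      replace 0 with (- (hbar * k / M) * (0 / k * (x / (x ^ 2 + y ^ 2)))) at 2
        by (unfold Rdiv at 2; ring).
      exact h. }
  intros hd e. assert (hm : 0 < delta / k) by now apply Rdiv_lt_0_compat.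
  split; [|split; [|split; [|split; [|split]]]].
  - intros O (a & b & g & [Hg _] & HO).
    destruct (itv_point a b (proj1 Hg)) as (t0 & ht0).
    exists (Ham hbar M k (fst (g t0)) (snd (g t0)) delta). intros p Hp.
    destruct (proj1 (HO p) Hp) as (t & ht & <-). split.
    + right. now apply (orbit_ne_origin hbar M k delta a b).
    + now apply (Ham_constant hbar M k delta a b g).
  - intros O. now apply reflected_orbit.
  - intros p. now apply equilibrium_iff.
  - split; [now apply equilibrium_iff|]. eexists. split; [now apply filterdiff_field_equilibrium|].
    assert (hkap : 0 < hbar * k / M / (delta / k)).
    { repeat apply Rdiv_lt_0_compat; trivial. now apply Rmult_lt_0_compat. }
    set (kap := hbar * k / M / (delta / k)) in *.
    (* The linearization exchanges the coordinates up to the factor [- kap]: the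
       eigenvectors lie on the two diagonals. *)
    exists (- kap), kap. split; [lra|split].
    + exists (1, 1). split; [intros E; injection E; lra|].
      cbn [fst snd]. f_equal; ring.
    + exists (1, -1). split; [intros E; injection E; lra|].
      cbn [fst snd]. f_equal; ring.
  - intros O HO p. now apply separatrix_in_L.
  - set (m := delta / k) in *. assert (h1 : 0 < exp (-1) <= exp (-1)).
    { split; [apply exp_pos|lra]. }
    exists (fun p => contour m (exp (-1)) p /\ p <> e), (region m (exp (-1))).
    assert (He : contour m (exp (-1)) e).
    { unfold e. rewrite <- contour_point_0. now apply contour_contour_point. }
    assert (HC : forall p, (contour m (exp (-1)) p /\ p <> e) \/ p = e <->
                           contour m (exp (-1)) p).
    { intros p. split.
      - intros [[h _]| ->]; trivial.
      - intros h. destruct (classic (p = e)); tauto. }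
    split; [|split; [|split; [|split]]].
    + now apply loop_is_homoclinic.
    + destruct (contour_closed_curve m (exp (-1)) hm h1) as (c & c1 & c2 & c3 & c4).
      exists c. split; [|split; [|split]]; trivial.
      intros p. rewrite HC. apply c4.
    + destruct (contour_bounds_region m (exp (-1)) hm h1) as (b1 & b2 & b3 & b4).
      split; [|split; [|split]]; trivial. intros p. rewrite HC. apply b4.
    + now apply region_origin.
    + intros q hq hq0.
      destruct (contour_through m (exp (-1)) q hm hq hq0) as (E & hE & hqE).
      exists (contour m E). split; [|split; [|split]]; trivial.
      * now apply contour_is_cycle.
      * intros p. now apply contour_sub_region.
      * exists (region m E). split.
        -- apply contour_bounds_region; trivial. lra.
        -- now apply region_origin.
Qed.
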